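(* Let $c>0$, let $p_0\in C^2(\mathbb R^3)\cap L^\infty(\mathbb R^3)$ be a scalar function and let $\mathbf v_0:\mathbb R^3\to\mathbb R^3$ be a vector field with components in $C^2(\mathbb R^3)\cap L^\infty(\mathbb R^3)$. For $t\ge 0$ and $\mathbf x\in\mathbb R^3$ define $$p(t,\mathbf x)=p_0(\mathbf x)+\int_0^{ct}r\,\frac1{4\pi}\int_{S^2_1}(\operatorname{div}\operatorname{grad}p_0)(\mathbf x+r\mathbf y)\,d\mathbf y\,dr-ct\,\frac1{4\pi}\int_{S^2_1}(\operatorname{div}\mathbf v_0)(\mathbf x+ct\,\mathbf y)\,d\mathbf y,$$ $$\mathbf v(t,\mathbf x)=\mathbf v_0(\mathbf x)+\int_0^{ct}r\,\frac1{4\pi}\int_{S^2_1}(\operatorname{grad}\operatorname{div}\mathbf v_0)(\mathbf x+r\mathbf y)\,d\mathbf y\,dr-ct\,\frac1{4\pi}\int_{S^2_1}(\operatorname{grad}p_0)(\mathbf x+ct\,\mathbf y)\,d\mathbf y.$$ Then $(\mathbf v,p)$ is a (distributional) solution of the Cauchy problem $$\partial_t\mathbf v+c\,\operatorname{grad}p=0,\qquad \partial_t p+c\,\operatorname{div}\mathbf v=0,\qquad p(0,\mathbf x)=p_0(\mathbf x),\quad \mathbf v(0,\mathbf x)=\mathbf v_0(\mathbf x).$$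
   Context: $S^2_1$ is the unit sphere in $\mathbb R^3$ and $d\mathbf y$ on it denotes the (unnormalized) surface measure, of total mass $4\pi$. Distributional solution: $q=(\mathbf v,p)$, with each locally integrable function identified with the corresponding regular distribution on $\mathbb R^3$, is a $C^1$ map from $[0,\infty)$ into $(D'(\mathbb R^3))^4$, the equations hold for every $t$ as identities in $D'(\mathbb R^3)$ (spatial derivatives being distributional), and $q(0)$ equals the initial data. *)

(* Defs.v *)
From HB Require Import structures.
From mathcomp Require Import all_boot all_order all_algebra.
From mathcomp Require Import all_classical all_reals all_analysis.
Import Order.TTheory GRing.Theory Num.Theory.
Import numFieldNormedType.Exports.

Set Implicit Arguments.
Unset Strict Implicit.
Unset Printing Implicit Defensive.

Local Open Scope classical_set_scope.
Local Open Scope ring_scope.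

(* Points of R^3 are row vectors; they carry the max norm, which induces the
   same topology as the Euclidean norm. *)
Notation pt R := 'rV[R]_3.

Section VectorCalculus.
Context {R : realType}.
Implicit Types (f : pt R -> R) (w : pt R -> pt R) (x : pt R) (i : 'I_3).

Definition partial i f : pt R -> R := 'D_(delta_mx 0 i) f.

Definition grad f x : pt R := \row_i partial i f x.

Definition div w x : R := \sum_(i < 3) partial i (fun y => w y 0 i) x.

Fixpoint Ck (n : nat) f : Prop :=
  continuous f /\
  if n is m.+1 then
    forall i, (forall x, derivable f x (delta_mx 0 i)) /\ Ck m (partial i f)
  else True.

Definition smooth f : Prop := forall n, Ck n f.

Definition partials (s : seq 'I_3) f : pt R -> R := foldr partial f s.

Definition supp f : set (pt R) := closure [set x | f x != 0].

End VectorCalculus.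

Section Integration.
Context {R : realType}.

Notation leb := (@lebesgue_measure R).

(* The library puts Lebesgue measure on R only, hence the detour through
   R * R * R for the three-dimensional Lebesgue measure. *)
Definition R3 := (measurableTypeR R * measurableTypeR R * measurableTypeR R)%type.

Definition pt_of (z : R3) : pt R := \row_i [:: z.1.1; z.1.2; z.2]`_i.

Definition leb3 : {measure set R3 -> \bar R} := ((leb \x leb) \x leb)%E.

Definition integral3 (f : pt R -> R) : R := \int[leb3]_z f (pt_of z).

Definition loc_integrable (f : pt R -> R) : Prop :=
  measurable_fun setT (f \o pt_of : R3 -> R) /\
  forall K : set (pt R), compact K ->
    (\int[leb3]_(z in pt_of @^-1` K) `|f (pt_of z)|%:E < +oo)%E.

Definition Linfty (f : pt R -> R) : Prop := (f \o pt_of : R3 -> R) \in Lfun leb3 +oo%E.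

(* Colatitude z.1 in [0, pi] and longitude z.2 in [0, 2 pi]. *)
Definition sphere_pt (z : R * R) : pt R :=
  \row_i [:: sin z.1 * cos z.2; sin z.1 * sin z.2; cos z.1]`_i.

(* Surface integral over the unit sphere: the area element of [sphere_pt] is
   |d_1 sphere_pt x d_2 sphere_pt| = sin z.1. *)
Definition sphere_integral (g : pt R -> R) : R :=
  \int[(leb \x leb)%E]_(z in `[0, pi] `*` `[0, 2 * pi])
    (g (sphere_pt z) * sin z.1).

End Integration.

Section TestFunctions.
Context {R : realType}.
Implicit Types (f g : pt R -> R) (a : R) (i : 'I_3).

Definition test_pred : {pred pt R -> R} :=
  mem [set f : pt R -> R | smooth f /\ compact (supp f)].

Lemma Ck_lin n a f g : Ck n f -> Ck n g -> Ck n (a *: f + g).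
Proof.
elim: n f g => [|n IHn] f g /= [cf Df] [cg Dg];
  (split; first by move=> x; apply: continuousD;
    [apply: continuousZl_tmp; exact: cf|exact: cg]) => //.
move=> i; have [df Cf] := Df i; have [dg Cg] := Dg i; split.
  by move=> x; apply: derivableD => //; exact: derivableZ.
rewrite (_ : partial i (a *: f + g) = a *: partial i f + partial i g).
  exact: IHn.
by apply/funext => x; rewrite /partial deriveD ?deriveZ//; exact: derivableZ.
Qed.

Lemma Ck0 n : Ck n (0 : pt R -> R).
Proof.
elim: n => [|n IHn] /=; split=> //; try exact: cst_continuous.
move=> i; split=> [x|]; first exact: derivable_cst.
rewrite (_ : partial i 0 = 0)//.
by apply/funext => x; exact: derive_cst.
Qed.

Lemma sub_compact_supp f (K : set (pt R)) :
  compact K -> supp f `<=` K -> compact (supp f).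
Proof. by move=> cK fK; apply: subclosed_compact fK => //; exact: closed_closure. Qed.

Lemma test_submod_closed : submod_closed test_pred.
Proof.
split=> [|a f g]; rewrite !inE/=.
  split=> [n|]; first exact: Ck0.
  rewrite /supp (_ : [set _ | _] = set0) ?closure0; first exact: compact0.
  by apply/seteqP; split=> x //=; rewrite eqxx.
move=> [sf kf] [sg kg]; split=> [n|]; first exact: Ck_lin.
apply: sub_compact_supp (compactU kf kg) _; rewrite /supp -closureU.
apply: closure_subset => x /= fgx.
have [fx0|fx0] := eqVneq (f x) 0; last by left.
have [gx0|gx0] := eqVneq (g x) 0; last by right.
by move: fgx; rewrite !fctE fx0 gx0 scaler0 addr0 eqxx.
Qed.

HB.instance Definition _ :=
  GRing.isSubmodClosed.Build R (pt R -> R) test_pred test_submod_closed.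

Lemma supp_partial i f : [set x | partial i f x != 0] `<=` supp f.
Proof.
move=> x /= Dfx; apply: contrapT => fx.
have : open (~` supp f) by rewrite openC; exact: closed_closure.
rewrite openE => /(_ x fx) nfx; move/eqP: Dfx; apply.
rewrite /partial (@near_eq_derive _ _ _ f (cst 0)) ?derive_cst//.
apply: filterS nfx => y /= fy; apply: contrapT => /eqP fy0; apply: fy.
exact: subset_closure.
Qed.

Lemma supp_partialS i f : supp (partial i f) `<=` supp f.
Proof.
rewrite [X in _ `<=` X](closure_id _).1; last exact: closed_closure.
exact/closure_subset/supp_partial.
Qed.

Lemma test_partial i f : f \in test_pred -> partial i f \in test_pred.
Proof.
rewrite !inE/= => -[sf kf]; split=> [n|]; first by have [_ /(_ i)[]] := sf n.+1.
exact: sub_compact_supp kf (@supp_partialS i f).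
Qed.

End TestFunctions.

(* The space D(R^3) of real test functions *)
Record test_fun (R : realType) := TestFun {
  test_val :> pt R -> R ;
  test_valP : test_val \in test_pred }.

HB.instance Definition _ (R : realType) := [isSub for @test_val R].
HB.instance Definition _ (R : realType) := [Choice of test_fun R by <:].
HB.instance Definition _ (R : realType) :=
  [SubChoice_isSubLmodule of test_fun R by <:].

Definition test_D (R : realType) (i : 'I_3) (phi : test_fun R) : test_fun R :=
  TestFun (test_partial i (test_valP phi)).

(* [distr_cont] says that the functional is continuous on D(R^3): for
   every compact K it is bounded, on the test functions supported in K, by a
   multiple of the largest of the sup norms of the derivatives up to some
   order N. *)
Record distribution (R : realType) := Distribution {
  distr_val :> {linear test_fun R -> R} ;
  distr_cont : forall K : set (pt R), compact K ->
    exists (N : nat) (C : R), forall (phi : test_fun R) (M : R),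
      supp phi `<=` K ->
      (forall s : seq 'I_3, (size s <= N)%N ->
         forall x, `|partials s phi x| <= M) ->
      `|distr_val phi| <= C * M }.

Section Distributions.
Context {R : realType}.
Implicit Types (T : distribution R) (phi : test_fun R) (i : 'I_3).

Lemma test_D_linear i : linear (@test_D R i).
Proof.
move=> a phi psi; apply: val_inj => /=; apply/funext => x.
have d (chi : test_fun R) y : derivable chi y (delta_mx 0 i).
  have := test_valP chi; rewrite inE => -[+ _] => /(_ 1%N)[_ /(_ i)[dchi _]].
  exact: dchi.
by rewrite /partial deriveD ?deriveZ//; exact: derivableZ.
Qed.

Definition distr_D_val i T phi : R := - T (test_D i phi).

Lemma distr_D_linear i T : linear (distr_D_val i T).
Proof.
by move=> a phi psi; rewrite /distr_D_val test_D_linear linearP opprD scalerN.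
Qed.

HB.instance Definition _ i T :=
  GRing.isLinear.Build R (test_fun R) R _ (distr_D_val i T) (distr_D_linear i T).

Lemma distr_D_cont i T (K : set (pt R)) : compact K ->
  exists (N : nat) (C : R), forall phi (M : R),
    supp phi `<=` K ->
    (forall s : seq 'I_3, (size s <= N)%N ->
       forall x, `|partials s phi x| <= M) ->
    `|distr_D_val i T phi| <= C * M.
Proof.
move=> cK; have [N [C TC]] := distr_cont T cK.
exists N.+1, C => phi M phiK phiM; rewrite normrN; apply: TC => [|s sN x].
  by apply: subset_trans phiK; exact: supp_partialS.
have := phiM (rcons s i); rewrite size_rcons ltnS => /(_ sN x).
by rewrite /partials -cats1 foldr_cat.
Qed.

(* The distributional partial derivative d_i T *)
Definition distr_D i T : distribution R :=
  Distribution (@distr_D_cont i T).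

(* T is the regular distribution given by f. *)
Definition regular (f : pt R -> R) T : Prop :=
  loc_integrable f /\ forall phi, T phi = integral3 (fun x => f x * phi x).

(* D'(R^3) carries the weak-* topology, so that limits and continuity in
   D'(R^3) are tested against each test function separately. The derivative of
   q at t is taken within [0, +oo[, hence is one-sided at t = 0. *)
Definition distr_derive (q : R -> distribution R) (t : R) T : Prop :=
  forall phi,
    h^-1 * (q (t + h) phi - q t phi) @[h --> within [set h | 0 <= t + h] 0^']
      --> T phi.

Definition distr_continuous (q : R -> distribution R) : Prop :=
  forall phi, {within `[0, +oo[, continuous (fun t => q t phi)}.

(* q is a C^1 map from [0, +oo[ to D'(R^3), with derivative dq; values at
   negative times are irrelevant. *)
Definition distr_C1 (q dq : R -> distribution R) : Prop :=
  (forall t, 0 <= t -> distr_derive q t (dq t)) /\ distr_continuous dq.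

End Distributions.

Section CauchyProblem.
Context {R : realType}.

Definition sphere_mean (r : R) (g : pt R -> R) (x : pt R) : R :=
  (4 * pi)^-1 * sphere_integral (fun y => g (x + r *: y)).

Definition coordf (w : pt R -> pt R) (i : 'I_3) (x : pt R) : R := w x 0 i.

(* (v, p) is a distributional solution of
     d_t v + c grad p = 0, d_t p + c div v = 0, v(0) = v0, p(0) = p0. *)
Definition distributional_solution (c : R) (v0 : pt R -> pt R) (p0 : pt R -> R)
    (v : R -> pt R -> pt R) (p : R -> pt R -> R) : Prop :=
  exists (V dV : 'I_3 -> R -> distribution R) (P dP : R -> distribution R),
  [/\ (forall t, 0 <= t ->
         (forall i, regular (coordf (v t) i) (V i t)) /\ regular (p t) (P t)),
      (forall i, distr_C1 (V i) (dV i)) /\ distr_C1 P dP,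
      (forall t, 0 <= t -> forall i (phi : test_fun R),
         dV i t phi + c * distr_D i (P t) phi = 0),
      (forall t, 0 <= t -> forall phi : test_fun R,
         dP t phi + c * \sum_(i < 3) distr_D i (V i t) phi = 0) &
      (forall i, regular (coordf v0 i) (V i 0)) /\ regular p0 (P 0)].

End CauchyProblem.

(* Main.v *)
From HB Require Import structures.
Require Import Defs.
From mathcomp Require Import all_boot all_order all_algebra.
From mathcomp Require Import all_classical all_reals all_analysis.
From mathcomp Require Import ring lra.
Import Order.TTheory GRing.Theory Num.Theory.
Import numFieldNormedType.Exports.
Local Open Scope classical_set_scope.
Local Open Scope ring_scope.

(* Pairing the fields with a test function phi turns them into the correlations
   H_g(z) = int g(x + z) phi(x) dx: the spherical means and the integral over x
   commute, so <M_r g, phi> = M_r H_g(0). For g of class C^1, integration by parts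
   gives d_i H_g = H_(d_i g), which is also minus the correlation of g with
   d_i phi, so that H_g is smooth; writing u_H(s) = s M_s H(0), Darboux's equation
   u_H'' = u_(Delta H), u_H'(0) = H(0), yields
     <p(t), phi> = u_H'(ct) - u_G(ct),  H = H_(p0), G = H_(div v0),
   whose time derivative is c (u_(Delta H) - u_G')(ct). The same quantity is
   c sum_i <v_i(t), d_i phi>, and the equation for v is obtained in the same way.
   Darboux's equation itself comes from the pointwise identity
     s sin(th) Delta F(s y)
       = sin(th) d_s^2 (s F(s y)) + d_th (sin(th) e_th . grad F) + d_la (e_la . grad F),
   in which the last two terms integrate to zero over the sphere. *)

Set Implicit Arguments.
Unset Strict Implicit.
Unset Printing Implicit Defensive.

(** * Measurability and Fubini's theorem for continuous functions *)

(** The averaged functions grad div v0 and Delta p0 are merely continuous and cannot be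
    differentiated under the integral; the spatial derivatives are therefore moved to phi. A
    correlation with a C^1 function is already C^2, one derivative falling on each factor, and this
    makes Darboux's equation available for div v0, which is only C^1. The formula for v contains
    grad div in place of the Laplacian, so Darboux's equation does not apply to a single component
    of v. In the equation for v it enters on the side of p, tested against d_i phi; in the equation
    for p it enters on the side of v after summation over i. Fubini's theorem and differentiation
    under the integral sign are needed for segments, for the sphere and for cubes, with parameters
    in several spaces. They are obtained for an abstract class of functionals, closed under
    iteration and under weighted pull-back along continuous maps. The factor s sin(th) in the
    pointwise identity makes all its terms continuous at the poles and at s = 0, where the Laplacian
    in spherical coordinates is singular. *)

Section ContinuousIntegrals.
Context {R : realType}.
Notation leb := (@lebesgue_measure R).

(* f is the pointwise limit of the functions f (x, floor (n y) / n). *)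
Lemma measurable_fun_caratheodory d (T : measurableType d) (f : T * R -> R) :
  (forall y, measurable_fun setT (fun x => f (x, y))) ->
  (forall x, continuous (fun y => f (x, y))) ->
  measurable_fun setT (f : T * measurableTypeR R -> R).
Proof.
move=> mf cf.
pose g n (y : R) : R := (Num.floor (y * n.+1%:R))%:~R / n.+1%:R.
apply: (@measurable_realfun.measurable_fun_cvg _ _ _ _ (fun n z => f (z.1, g n z.2))).
  move=> n _ B mB; rewrite setTI.
  rewrite (_ : _ @^-1` _ = \bigcup_(k : int)
      ((fun x => f (x, k%:~R / n.+1%:R)) @^-1` B `*`
       `[k%:~R / n.+1%:R, (k + 1)%:~R / n.+1%:R[)); last first.
    apply/seteqP; split=> [[x y] /= Bxy|[x y] [k _ [/= Bx]]].
      exists (Num.floor (y * n.+1%:R)) => //=; split=> //.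
      rewrite in_itv/= ler_pdivrMr// ltr_pdivlMr//; exact: floor_itv.
    rewrite in_itv/= ler_pdivrMr// ltr_pdivlMr// => ky.
    by rewrite /g (floor_def ky).
  apply: countable_bigcupT_measurable => // k.
  apply: measurableX; last exact: measurable_itv.
  by rewrite -[X in measurable X]setTI; exact: mf.
move=> [x y] _ /=.
apply: (cvg_comp (g ^~ y) (fun y => f (x, y)) _ (cf x y)).
apply/cvgrPdist_le => /= e e0.
near=> n.
have /andP[h1 h2] := floor_itv (y * n.+1%:R).
rewrite /g; set k := Num.floor _ in h1 h2 *.
rewrite ger0_norm ?subr_ge0 ?ler_pdivrMr//.
have {1}-> : y = y * n.+1%:R / n.+1%:R by rewrite mulfK.
rewrite -mulrBl ler_pdivrMr//.
suff : 1 <= e * n.+1%:R by rewrite intrD in h2; lra.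
rewrite -ler_pdivrMr// mul1r.
by apply: ltW; near: n; exact: near_infty_natSinv_lt (PosNum e0).
Unshelve. all: by end_near. Qed.


Section FubiniSegment.
Context d (T : measurableType d) (mu : {sigma_finite_measure set T -> \bar R}).
Variables (D : set T) (a b M : R) (G : T * R -> R).
Hypotheses (mD : measurable D) (muD : (mu D < +oo)%E).
Hypothesis mG : measurable_fun setT (G : T * measurableTypeR R -> R).
Hypothesis GM : forall x y, D x -> y \in `[a, b] -> `|G (x, y)| <= M.

Let E : set (T * measurableTypeR R) := D `*` `[a, b].

Let mE : measurable E.
Proof. exact: measurableX. Qed.

Let intG : (mu \x leb)%E.-integrable setT (EFin \o (G \_ E)).
Proof.
rewrite -restrict_EFin; apply/integrable_restrict => //; rewrite setTI.
apply: measurable_bounded_integrable => //.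
- rewrite /E /= product_measure1E//=; apply: lte_mul_pinfty => //.
    by rewrite fin_num_abs ?gee0_abs.
  by rewrite lebesgue_measure_itv/=; case: ifP => // _; rewrite -EFinD ltry.
- exact: measurable_funTS.
- exists M; split; first exact: num_real.
  move=> N MN [x y] [/= Dx aby]; apply: le_trans (ltW MN); exact: GM.
Qed.

Let intx x : D x -> leb.-integrable `[a, b] (EFin \o (fun y => G (x, y))).
Proof.
move=> Dx; apply: measurable_bounded_integrable => //.
- by rewrite /= lebesgue_measure_itv/=; case: ifP => // _; rewrite -EFinD ltry.
- apply: measurable_funTS; exact: measurableT_comp mG (measurable_pair1 x).
- exists M; split; first exact: num_real.
  move=> N MN y /= aby; apply: le_trans (ltW MN); exact: GM.
Qed.

Let inty y : y \in `[a, b] -> mu.-integrable D (EFin \o (fun x => G (x, y))).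
Proof.
move=> aby; apply: measurable_bounded_integrable => //.
- apply: measurable_funTS; exact: measurableT_comp mG (measurable_pair2 y).
- exists M; split; first exact: num_real.
  move=> N MN x /= Dx; apply: le_trans (ltW MN); exact: GM.
Qed.

(** Real-valued integrals are [fine] parts of extended ones, so Fubini's theorem transfers only once
    every section is integrable; boundedness on a set of finite measure provides this. *)
Lemma Rintegral_prod_segment :
  \int[(mu \x leb)%E]_(z in D `*` `[a, b]) G z =
  \int[mu]_(x in D) \int[leb]_(y in `[a, b]) G (x, y).
Proof.
rewrite Rintegral_mkcond /Rintegral -(integral12_prod_meas1 intG).
congr fine; rewrite [RHS]integral_mkcond; apply: eq_integral => x _.
rewrite /fubini_F patchE; case: ifPn => [xD|xD].
  rewrite fineK; last by apply: integrable_fin_num; last exact: intx (set_mem xD).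
  rewrite [RHS]integral_mkcond; apply: eq_integral => y _ /=.
  by rewrite !patchE /E in_setX xD; case: (y \in _).
by rewrite [RHS](_ : _ = 0%E)//; apply: integral0_eq => y _ /=;
  rewrite patchE /E in_setX/= (negbTE xD).
Qed.

Lemma Rintegral_prod_segment_swap :
  \int[(mu \x leb)%E]_(z in D `*` `[a, b]) G z =
  \int[leb]_(y in `[a, b]) \int[mu]_(x in D) G (x, y).
Proof.
rewrite Rintegral_mkcond /Rintegral -(integral21_prod_meas1 intG).
congr fine; rewrite [RHS]integral_mkcond; apply: eq_integral => y _.
rewrite /fubini_G patchE; case: ifPn => [/set_mem yab|yab].
  rewrite fineK; last by apply: integrable_fin_num; last exact: inty yab.
  rewrite [RHS]integral_mkcond; apply: eq_integral => x _ /=.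
  by rewrite !patchE /E in_setX (mem_set yab) andbT; case: (x \in _).
by rewrite [RHS](_ : _ = 0%E)//; apply: integral0_eq => x _ /=;
  rewrite patchE /E in_setX/= (negbTE yab) andbF.
Qed.

End FubiniSegment.

End ContinuousIntegrals.

(** * Integration functionals and differentiation under the integral sign *)

Section Integrators.
Context {R : realType}.
Notation leb := (@lebesgue_measure R).

(** Not an oriented integral: it vanishes for [b < a] instead of changing sign. A derivative in the
    upper endpoint is therefore taken with a base point strictly to the left. *)
Definition segint (a b : R) (f : R -> R) : R := \int[leb]_(x in `[a, b]) f x.

Lemma continuous_pair (T U V : topologicalType) (f : T -> U) (g : T -> V) :
  continuous f -> continuous g -> continuous (fun t => (f t, g t)).
Proof. by move=> cf cg t; apply: cvg_pair; [exact: cf|exact: cg]. Qed.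

Lemma continuous_compose (T U V : topologicalType) (f : T -> U) (g : U -> V) :
  continuous g -> continuous f -> continuous (fun t => g (f t)).
Proof. by move=> cg cf t; exact: continuous_comp (cf t) (cg _). Qed.

Lemma continuous_section (T U V : topologicalType) (F : T * U -> V) (t : T) :
  continuous F -> continuous (fun y => F (t, y)).
Proof.
move=> cF; apply: continuous_compose cF _.
by apply: continuous_pair => ?; [exact: cvg_cst|exact: cvg_id].
Qed.

Arguments continuous_section {T U V F} t _ _ _.

Lemma continuous_segment_integrable a b (f : R -> R) : continuous f ->
  leb.-integrable `[a, b] (EFin \o f).
Proof.
move=> cf; apply: continuous_compact_integrable; first exact: segment_compact.
exact: continuous_subspaceT.
Qed.

Lemma segint_eq a b (f g : R -> R) : (forall x, a <= x <= b -> f x = g x) ->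
  segint a b f = segint a b g.
Proof. by move=> fg; apply: eq_Rintegral => x; rewrite inE/= in_itv; exact: fg. Qed.

Lemma segint_gt a b (f : R -> R) : b < a -> segint a b f = 0.
Proof. by move=> ba; rewrite /segint set_itv_ge ?bnd_simp ?lt_geF// Rintegral_set0. Qed.

Lemma segint_cst a b (k : R) : a <= b -> segint a b (cst k) = k * (b - a).
Proof.
move=> ab; rewrite /segint Rintegral_cst//= lebesgue_measure_itv/=.
case: ifPn => //; rewrite lte_fin -leNgt => ba.
by have -> : b = a; [lra|rewrite subrr].
Qed.

Lemma segint_FTC a b (f F : R -> R) : a <= b -> continuous f ->
  (forall x, is_derive x (1:R) F (f x)) -> segint a b f = F b - F a.
Proof.
rewrite le_eqVlt => /predU1P[<- _ _|ab cf dF].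
  by rewrite /segint set_itv1 Rintegral_set1 subrr.
have cF : continuous F.
  by move=> x; exact/differentiable_continuous/derivable1_diffP/(@ex_derive _ _ _ _ _ _ _ (dF x)).
rewrite /segint /Rintegral (continuous_FTC2 (F := F)) //.
- exact: continuous_subspaceT.
- split=> [x _||]; first exact: (@ex_derive _ _ _ _ _ _ _ (dF x)).
    exact: cvg_at_right_filter (cF a).
  exact: cvg_at_left_filter (cF b).
- by move=> x _; rewrite derive1E; exact: (@derive_val _ _ _ _ _ _ _ (dF x)).
Qed.

(* The functionals below are iterated integrals over segments; commuting with
   [segint] (Fubini) is what yields differentiation under the integral sign. *)
Definition integrator (Y : topologicalType) (J : (Y -> R) -> R) : Prop :=
  [/\ forall (k : R) f g, continuous f -> continuous g ->
        J (fun y => k * f y + g y) = k * J f + J g,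
      forall (T : topologicalType) (F : T * Y -> R), continuous F ->
        continuous (fun t => J (fun y => F (t, y))) &
      forall a b (F : R * Y -> R), continuous F ->
        J (fun y => segint a b (fun x => F (x, y))) =
        segint a b (fun x => J (fun y => F (x, y)))].

(** The parameter lives in an arbitrary topological space, so its continuity clause comes from a
    tube argument over the compact segment rather than from convergence of sequences. The exchange
    clause is Fubini's theorem on a rectangle, with the bound given by compactness. *)
Lemma segint_integrator a b : integrator (segint a b).
Proof.
split.
- move=> k f g cf cg; rewrite /segint RintegralD//.
  + by rewrite RintegralZl//; exact: continuous_segment_integrable.
  + apply: continuous_segment_integrable => x.
    by apply: cvgM; [exact: cvg_cst|exact: cf].
  + exact: continuous_segment_integrable.
- move=> T F cF t0.
  have [ba|ab] := ltP b a.
    under eq_fun do rewrite segint_gt//; exact: cvg_cst.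
  apply/cvgrPdist_le => /= e e0.
  (* The summand 1 keeps the denominator positive when [a = b]. *)
  pose dl := e / (b - a + 1).
  have dl0 : 0 < dl by rewrite divr_gt0//; lra.
  have cov : \forall t \near t0,
      `[a, b] `<=` [set y | `|F (t0, y) - F (t, y)| <= dl].
    have /compact_near_coveringP cpt := @segment_compact R a b.
    apply: (cpt _ (nbhs t0) (fun t y => `|F (t0, y) - F (t, y)| <= dl)) => y _.
    have /cvgrPdist_le /(_ (dl / 2)) := cF (t0, y).
    rewrite divr_gt0// => /(_ isT) Fy.
    have [[/= A B] [At By] AB] := Fy.
    exists (B, A) => //= -[y' t'] /= [By' At'].
    have := AB (t0, y') (conj (nbhs_singleton At) By').
    have := AB (t', y') (conj At' By').
    rewrite /= !ler_norml => /andP[? ?] /andP[? ?]; apply/andP; split; lra.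
  near=> t.
  have /= tP := near cov t.
  have iF t1 := continuous_segment_integrable a b (continuous_section t1 cF).
  have iB : leb.-integrable `[a, b] (EFin \o (fun y => F (t0, y) - F (t, y))).
    apply: continuous_segment_integrable => y.
    by apply: cvgB; exact: continuous_section.
  rewrite /segint -RintegralB//.
  apply: le_trans (le_normr_Rintegral _ iB) _ => //.
  apply: (@le_trans _ _ (segint a b (cst dl))).
    apply: le_Rintegral => //.
    + apply: continuous_segment_integrable => y.
      apply: cvg_norm; apply: cvgB; exact: continuous_section.
    + exact/continuous_segment_integrable/cst_continuous.
    + by move=> x xab; apply: tP => //; near: t.
  rewrite segint_cst// /dl mulrAC ler_pdivrMr; last lra.
  by rewrite ler_pM2l//; lra.
- move=> c d F cF; rewrite /segint.
  have [M FM] : exists M, forall x y, `[c, d]%classic x -> y \in `[a, b] -> `|F (x, y)| <= M.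
    have cK : compact (F @` (`[c, d] `*` `[a, b])).
      apply: continuous_compact; first exact: continuous_subspaceT.
      by apply: compact_setX; exact: segment_compact.
    have [M [_ /(_ (M + 1))]] := compact_bounded cK.
    rewrite ltrDl ltr01 => /(_ isT) MF; exists (M + 1) => x y xcd yab.
    by apply: MF => /=; exists (x, y).
  (* Fubini's theorem asks for measurability in the product sigma-algebra, which is obtained from
     continuity in each variable separately. *)
  have mF : measurable_fun setT (F : measurableTypeR R * measurableTypeR R -> R).
    apply: (@measurable_fun_caratheodory R _ (measurableTypeR R) F) => [y|x];
      last exact: continuous_section.
    apply: measurable_realfun.continuous_measurable_fun; apply: continuous_compose cF _.
    by apply: continuous_pair => ?; [exact: cvg_id|exact: cvg_cst].
  have m1 : (lebesgue_measure (`[c, d] : set R) < +oo)%E.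
    by rewrite /= lebesgue_measure_itv/=; case: ifP => // _; rewrite -EFinD ltry.
  have := @Rintegral_prod_segment _ _ _ leb `[c, d] a b M F _ m1 mF FM.
  have := @Rintegral_prod_segment_swap _ _ _ leb `[c, d] a b M F _ m1 mF FM.
  by move=> <-// <-.
Unshelve. all: by end_near. Qed.

End Integrators.

Section IntegratorTheory.
Context {R : realType}.

Lemma integrator_cst0 (Y : topologicalType) (J : (Y -> R) -> R) :
  integrator J -> J (fun=> 0) = 0.
Proof.
move=> [Jl _ _].
have := Jl 1 (fun=> 0) (fun=> 0) (@cst_continuous _ _ _) (@cst_continuous _ _ _).
by under eq_fun do rewrite mulr0 addr0; lra.
Qed.

Lemma integratorZ (Y : topologicalType) (J : (Y -> R) -> R) (k : R) (f : Y -> R) :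
  integrator J -> continuous f -> J (fun y => k * f y) = k * J f.
Proof.
move=> IJ cf; have [Jl _ _] := IJ.
rewrite -[RHS]addr0 -(integrator_cst0 IJ) -Jl//; last exact: cst_continuous.
by under [in RHS]eq_fun do rewrite addr0.
Qed.

Lemma integratorD (Y : topologicalType) (J : (Y -> R) -> R) (f g : Y -> R) :
  integrator J -> continuous f -> continuous g ->
  J (fun y => f y + g y) = J f + J g.
Proof.
move=> [Jl _ _] cf cg; rewrite -[J f]mul1r -Jl//.
by under [in RHS]eq_fun do rewrite mul1r.
Qed.

Lemma integratorN (Y : topologicalType) (J : (Y -> R) -> R) (f : Y -> R) :
  integrator J -> continuous f -> J (fun y => - f y) = - J f.
Proof.
by move=> IJ cf; rewrite -mulN1r -integratorZ//; under [in RHS]eq_fun do rewrite mulN1r.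
Qed.

(** The continuity clause for the inner functional supplies the continuous integrand that the outer
    one expects; this is why that clause allows any parameter space. *)
Lemma integrator_comp (Y Z : topologicalType) (J : (Y -> R) -> R) (K : (Z -> R) -> R) :
  integrator J -> integrator K ->
  integrator (fun f : Y * Z -> R => J (fun y => K (fun z => f (y, z)))).
Proof.
move=> [Jl Jc Js] [Kl Kc Ks]; split.
- move=> k f g cf cg; rewrite -Jl; [|exact: Kc|exact: Kc]; congr J.
  by apply/funext => y; rewrite Kl//; exact: continuous_section.
- move=> T F cF; pose G (u : T * Y) := K (fun z => F (u.1, (u.2, z))).
  apply: (Jc _ G); apply: (Kc _ (fun v : T * Y * Z => F (v.1.1, (v.1.2, v.2)))).
  apply: continuous_compose cF _; apply: continuous_pair.
    by apply: continuous_compose => ?; exact: cvg_fst.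
  apply: continuous_pair; last by move=> ?; exact: cvg_snd.
  by apply: (@continuous_compose _ _ _ fst snd) => ?; [exact: cvg_snd|exact: cvg_fst].
- move=> a b F cF.
  transitivity (J (fun y => segint a b (fun x => K (fun z => F (x, (y, z)))))).
    congr J; apply/funext => y; apply: (Ks _ _ (fun u => F (u.1, (y, u.2)))).
    apply: continuous_compose cF _; apply: continuous_pair => [?|]; first exact: cvg_fst.
    by apply: continuous_pair => ?; [exact: cvg_cst|exact: cvg_snd].
  apply: (Js _ _ (fun u => K (fun z => F (u.1, (u.2, z))))).
  apply: (Kc _ (fun v : R * Y * Z => F (v.1.1, (v.1.2, v.2)))).
  apply: continuous_compose cF _; apply: continuous_pair.
    by apply: continuous_compose => ?; exact: cvg_fst.
  apply: continuous_pair; last by move=> ?; exact: cvg_snd.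
  by apply: (@continuous_compose _ _ _ fst snd) => ?; [exact: cvg_snd|exact: cvg_fst].
Qed.

(** Meant for integrals over parametrized sets: [e] is the parametrization and [w] its volume or
    area element. *)
Lemma integrator_pull (Y Z : topologicalType) (J : (Y -> R) -> R) (e : Y -> Z)
    (w : Y -> R) : continuous e -> continuous w -> integrator J ->
  integrator (fun f : Z -> R => J (fun y => f (e y) * w y)).
Proof.
move=> ce cw [Jl Jc Js].
have cM (T : topologicalType) (F : T * Z -> R) : continuous F ->
    continuous (fun u : T * Y => F (u.1, e u.2) * w u.2).
  move=> cF u; apply: cvgM.
    apply: (@continuous_compose _ _ _ (fun u : T * Y => (u.1, e u.2)) F cF).
    apply: continuous_pair => [?|]; first exact: cvg_fst.
    by apply: continuous_compose ce _ => ?; exact: cvg_snd.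
  by apply: (@continuous_compose _ _ _ snd w cw) => ?; exact: cvg_snd.
have c1 (f : Z -> R) : continuous f -> continuous (fun y => f (e y) * w y).
  move=> cf y; apply: cvgM; last exact: cw.
  exact: (@continuous_compose _ _ _ e f cf ce).
split.
- move=> k f g cf cg; rewrite -Jl; [|exact: c1|exact: c1]; congr J.
  by apply/funext => y; rewrite mulrDl mulrA.
- by move=> T F cF; exact: (Jc _ (fun u => F (u.1, e u.2) * w u.2) (cM _ _ cF)).
- move=> a b F cF; rewrite -(Js a b _ (cM _ _ cF)); congr J; apply/funext => y /=.
  rewrite mulrC -(integratorZ _ (@segint_integrator R a b)).
    by congr segint; apply/funext => x; rewrite mulrC.
  apply: continuous_compose cF _.
  by apply: continuous_pair => ?; [exact: cvg_id|exact: cvg_cst].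
Qed.

(** Fubini's theorem for a pair of functionals. An integrator commutes by definition with segments
    only; the closure lemmas below extend this to the integral over the sphere. *)
Definition commuting (Y Z : topologicalType) (J : (Y -> R) -> R) (K : (Z -> R) -> R) :=
  forall F : Y * Z -> R, continuous F ->
    J (fun y => K (fun z => F (y, z))) = K (fun z => J (fun y => F (y, z))).

Lemma commuting_segint (Y : topologicalType) (J : (Y -> R) -> R) a b :
  integrator J -> commuting J (segint a b).
Proof.
move=> [_ _ Js] F cF; apply: (Js _ _ (fun u => F (u.2, u.1))).
by apply: continuous_compose cF _; apply: continuous_pair => ?;
  [exact: cvg_snd|exact: cvg_fst].
Qed.

Lemma commuting_comp (X Y Z : topologicalType) (J : (X -> R) -> R)
    (K : (Y -> R) -> R) (L : (Z -> R) -> R) :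
  integrator L -> commuting J K -> commuting J L ->
  commuting J (fun f : Y * Z -> R => K (fun y => L (fun z => f (y, z)))).
Proof.
move=> [_ Lc _] JK JL F cF.
rewrite (JK (fun u => L (fun z => F (u.1, (u.2, z))))); last first.
  apply: (Lc _ (fun v : X * Y * Z => F (v.1.1, (v.1.2, v.2)))).
  apply: continuous_compose cF _; apply: continuous_pair.
    by apply: continuous_compose => ?; exact: cvg_fst.
  apply: continuous_pair; last by move=> ?; exact: cvg_snd.
  by apply: (@continuous_compose _ _ _ fst snd) => ?; [exact: cvg_snd|exact: cvg_fst].
congr K; apply/funext => y; apply: (JL (fun u => F (u.1, (y, u.2)))).
apply: continuous_compose cF _; apply: continuous_pair => [?|]; first exact: cvg_fst.
by apply: continuous_pair => ?; [exact: cvg_cst|exact: cvg_snd].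
Qed.

Lemma commuting_pull (X Y Z : topologicalType) (J : (X -> R) -> R)
    (K : (Y -> R) -> R) (e : Y -> Z) (w : Y -> R) :
  integrator J -> continuous e -> continuous w -> commuting J K ->
  commuting J (fun f : Z -> R => K (fun y => f (e y) * w y)).
Proof.
move=> IJ ce cw JK F cF.
rewrite (JK (fun u => F (u.1, e u.2) * w u.2)) /=; last first.
  move=> u; apply: cvgM.
    apply: (@continuous_compose _ _ _ (fun u : X * Y => (u.1, e u.2)) F cF).
    apply: continuous_pair => [?|]; first exact: cvg_fst.
    by apply: continuous_compose ce _ => ?; exact: cvg_snd.
  by apply: (@continuous_compose _ _ _ snd w cw) => ?; exact: cvg_snd.
congr K; apply/funext => y.
rewrite [RHS]mulrC -(integratorZ _ IJ).
  by congr J; apply/funext => x; rewrite mulrC.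
apply: continuous_compose cF _.
by apply: continuous_pair => ?; [exact: cvg_id|exact: cvg_cst].
Qed.

(* J (F (s, .)) = J (F (a, .)) + int_a^s J (dF (x, .)) dx for a < s. *)
Lemma integrator_is_derive (Y : topologicalType) (J : (Y -> R) -> R)
    (F dF : R * Y -> R) (s : R) :
  integrator J -> continuous F -> continuous dF ->
  (forall s y, is_derive s (1 : R) (fun s => F (s, y)) (dF (s, y))) ->
  is_derive s (1 : R) (fun s => J (fun y => F (s, y))) (J (fun y => dF (s, y))).
Proof.
move=> IJ cF cdF dFE; have [_ Jc Js] := IJ.
(* With a base point strictly below [s], the segment from [a] to [x] is nondegenerate for all [x]
   near [s], on either side. *)
pose a := s - 1; pose g x := J (fun y => dF (x, y)).
have cg : continuous g := Jc _ _ cdF.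
have E x : a < x -> J (fun y => F (a, y)) + segint a x g = J (fun y => F (x, y)).
  move=> ax; rewrite -Js// -integratorD//; last 2 first.
  - exact: continuous_section.
  - have [_ Ic _] := @segint_integrator R a x.
    apply: (Ic _ (fun u => dF (u.2, u.1))); apply: continuous_compose cdF _.
    by apply: continuous_pair => ?; [exact: cvg_snd|exact: cvg_fst].
  congr J; apply/funext => y.
  rewrite (@segint_FTC _ a x (fun x => dF (x, y)) (fun x => F (x, y))) ?ltW//.
    by rewrite subrKC.
  apply: continuous_compose cdF _.
  by apply: continuous_pair => ?; [exact: cvg_id|exact: cvg_cst].
apply: (@near_eq_is_derive _ _ _ (fun x => J (fun y => F (a, y)) + segint a x g)).
  near=> x; apply: E; near: x; apply: lt_nbhsr; rewrite /a; lra.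
have [] := @continuous_FTC1_closed R g a s (s + 1) _ _ _ (cg s).
- by rewrite ltrDl.
- exact: continuous_segment_integrable.
- by rewrite /a ltrBlDr ltrDl.
move=> D1 D2.
have D : is_derive s (1 : R) (fun x => segint a x g) (g s).
  by split=> //; rewrite -derive1E.
rewrite -[X in is_derive _ _ _ X]add0r.
exact: (@is_deriveD _ _ _ (cst (J (fun y => F (a, y)))) (fun x => segint a x g)).
Unshelve. all: by end_near. Qed.

End IntegratorTheory.

(** * Sphere and box integrals in R^3 *)

Section Continuity.
Context {R : realType} {T : topologicalType}.

Lemma continuous_add (f g : T -> R) :
  continuous f -> continuous g -> continuous (fun t => f t + g t).
Proof. by move=> cf cg t; apply: cvgD; [exact: cf|exact: cg]. Qed.

Lemma continuous_opp (f : T -> R) : continuous f -> continuous (fun t => - f t).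
Proof. by move=> cf t; apply: cvgN; exact: cf. Qed.

Lemma continuous_mul (f g : T -> R) :
  continuous f -> continuous g -> continuous (fun t => f t * g t).
Proof. by move=> cf cg t; apply: cvgM; [exact: cf|exact: cg]. Qed.

Lemma continuous_bigsum n (f : 'I_n -> T -> R) :
  (forall i, continuous (f i)) -> continuous (fun t => \sum_(i < n) f i t).
Proof.
move=> cf; elim: n f cf => [|n IH] f cf.
  by under eq_fun do rewrite big_ord0; exact: cst_continuous.
under eq_fun do rewrite big_ord_recr.
by apply: continuous_add; [apply: IH => i; exact: cf|exact: cf].
Qed.

Lemma continuous_row n (f : T -> 'rV[R]_n) :
  (forall i, continuous (fun t => f t 0 i)) -> continuous f.
Proof.
move=> cf t; apply/cvgrPdist_lt => e e0.
have : \forall s \near t, forall i, `|f t 0 i - f s 0 i| < e.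
  by apply: filter_forall => i; move/cvgrPdist_lt: (cf i t); exact.
apply: filterS => s fs; rewrite -[`|_|]/(mx_norm _) mx_normrE.
by apply/bigmax_ltP; split=> // -[j i] _; rewrite !mxE ord1.
Qed.

Lemma continuous_coord n (f : T -> 'rV[R]_n) i :
  continuous f -> continuous (fun t => f t 0 i).
Proof.
move=> cf.
exact: (@continuous_compose _ _ _ f (fun M => M 0 i) (@coord_continuous _ _ _ 0 i) cf).
Qed.

Lemma continuous_vadd n (f g : T -> 'rV[R]_n) :
  continuous f -> continuous g -> continuous (fun t => f t + g t).
Proof. by move=> cf cg t; apply: cvgD; [exact: cf|exact: cg]. Qed.

Lemma continuous_vscale n (k : T -> R) (f : T -> 'rV[R]_n) :
  continuous k -> continuous f -> continuous (fun t => k t *: f t).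
Proof. by move=> ck cf t; apply: cvgZ; [exact: ck|exact: cf]. Qed.

Lemma continuous_fst (U V : topologicalType) (f : T -> U * V) :
  continuous f -> continuous (fun t => (f t).1).
Proof. by apply: continuous_compose => ?; exact: cvg_fst. Qed.

Lemma continuous_snd (U V : topologicalType) (f : T -> U * V) :
  continuous f -> continuous (fun t => (f t).2).
Proof. by apply: continuous_compose => ?; exact: cvg_snd. Qed.

Lemma continuous_sin_comp (f : T -> R) :
  continuous f -> continuous (fun t => sin (f t)).
Proof. exact/continuous_compose/continuous_sin. Qed.

Lemma continuous_cos_comp (f : T -> R) :
  continuous f -> continuous (fun t => cos (f t)).
Proof. exact/continuous_compose/continuous_cos. Qed.

End Continuity.

Lemma ord3_ind (P : 'I_3 -> Prop) : P 0 -> P 1 -> P (1 + 1) -> forall i, P i.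
Proof.
by move=> P0 P1 P2 [[|[|[|//]]] i3]; [move: P0|move: P1|move: P2];
  congr P; apply: val_inj.
Qed.

Lemma row3E (R : realType) (x y z : R) (i : 'I_3) :
  ((\row_i [:: x; y; z]`_i) : pt R) 0 i = [:: x; y; z]`_i.
Proof. by rewrite mxE. Qed.

Section SphericalCoordinates.
Context {R : realType} {T : topologicalType}.

Lemma continuous_row3 (f g h : T -> R) :
  continuous f -> continuous g -> continuous h ->
  continuous (fun t => (\row_i [:: f t; g t; h t]`_i : pt R)).
Proof.
move=> cf cg ch; apply: continuous_row => i.
rewrite (_ : (fun t => _) = (fun t => [:: f t; g t; h t]`_i)); last first.
  by apply/funext => t; rewrite mxE.
by move: i; apply: ord3_ind.
Qed.

Lemma continuous_sphere_pt (f : T -> R * R) :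
  continuous f -> continuous (fun t => sphere_pt (f t)).
Proof.
move=> cf; have c1 := continuous_fst cf; have c2 := continuous_snd cf.
have [s1 k1] := (continuous_sin_comp c1, continuous_cos_comp c1).
have [s2 k2] := (continuous_sin_comp c2, continuous_cos_comp c2).
by apply: continuous_row3 => //; exact: continuous_mul.
Qed.

Lemma continuous_pt_of (f : T -> R * R * R) :
  continuous f -> continuous (fun t => pt_of (f t)).
Proof.
move=> cf; have c1 := continuous_fst cf; have c2 := continuous_snd cf.
by apply: continuous_row3 => //; [exact: continuous_fst|exact: continuous_snd].
Qed.

End SphericalCoordinates.

Ltac cont_hyp := match goal with
  | H : continuous ?f |- continuous ?f => exact H
  | H : forall _, continuous _ |- _ => simple apply H
  | H : forall _ _, continuous _ |- _ => simple apply H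
  end.

(** Directed by the body of the function: second-order patterns extract the parts, which are passed
    on explicitly so that no higher-order unification is left. An unknown outer function is accepted
    only if its continuity is a hypothesis, hence the many such facts put into contexts
    beforehand. *)
Ltac cont := first [cont_hyp |
  lazymatch goal with |- continuous ?h => lazymatch eval cbv beta in h with
  | (fun t => t) => by move=> ?; exact: cvg_id
  | (fun _ => ?c) => first [exact: cst_continuous | by move=> ?; exact: cvg_cst]
  | (fun t => (@?f t).1) => refine (@continuous_fst _ _ _ f _); cont
  | (fun t => (@?f t).2) => refine (@continuous_snd _ _ _ f _); cont
  | (fun t => (@?f t, @?g t)) => refine (@continuous_pair _ _ _ f g _ _); cont
  | (fun t => - @?f t) => refine (@continuous_opp _ _ f _); cont
  | (fun t => @?f t * @?g t) => refine (@continuous_mul _ _ f g _ _); cont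
  | (fun t => @?f t *: @?g t) => refine (@continuous_vscale _ _ _ f g _ _); cont
  | (fun t => sin (@?f t)) => refine (@continuous_sin_comp _ _ f _); cont
  | (fun t => cos (@?f t)) => refine (@continuous_cos_comp _ _ f _); cont
  | (fun t => \sum_(i < _) _) => apply: continuous_bigsum => ?; cont
  | (fun t => fun_of_matrix (@?f t) 0 ?i) => refine (@continuous_coord _ _ _ f i _); cont
  | (fun t => pt_of (@?f t)) => refine (@continuous_pt_of _ _ f _); cont
  | (fun t => sphere_pt (@?f t)) => refine (@continuous_sphere_pt _ _ f _); cont
  | (fun t => @?f t + @?g t) =>
      first [refine (@continuous_add _ _ f g _ _)
            |refine (@continuous_vadd _ _ _ f g _ _)]; cont
  | (fun t => ?F (@?f t)) =>
      refine (@continuous_compose _ _ _ f F _ _); [cont_hyp|cont]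
  | _ => first [by move=> ?; exact: cvg_id | by move=> ?; exact: cvg_fst
               |by move=> ?; exact: cvg_snd]
  end end].

Section PlaneMeasure.
Context {R : realType}.
Notation leb := (@lebesgue_measure R).

(* A copy of the product measure, because no sigma-finite structure is inferred for
   [leb \x leb] itself. *)
Definition plane_measure :
  set (measurableTypeR R * measurableTypeR R)%type -> \bar R := (leb \x leb)%E.

HB.instance Definition _ := Measure.copy plane_measure (leb \x leb)%E.

Lemma lebesgue_segment_lty (a b : R) : (leb `[a, b] < +oo)%E.
Proof. by rewrite /= lebesgue_measure_itv/=; case: ifP => // _; rewrite -EFinD ltry. Qed.

Lemma plane_measure_rect_lty (a b c d : R) :
  (plane_measure (`[a, b] `*` `[c, d]) < +oo)%E.
Proof.
rewrite /plane_measure product_measure1E//= lte_mul_pinfty//; last exact: lebesgue_segment_lty.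
by rewrite ge0_fin_numE//; exact: lebesgue_segment_lty.
Qed.

Lemma plane_measure_sigma_finite : sigma_finite setT plane_measure.
Proof.
exists (fun n => `[- n%:R, n%:R] `*` `[- n%:R, n%:R]).
  apply/seteqP; split=> // -[x y] _.
  exists (Num.truncn (Num.max `|x| `|y|)).+1 => //=; rewrite !in_itv/= -!ler_norml.
  have := truncnS_gt (Num.max `|x| `|y|); rewrite gt_max => /andP[xn yn].
  by split; exact: ltW.
by move=> n; split; [exact: measurableX|exact: plane_measure_rect_lty].
Qed.

HB.instance Definition _ :=
  Measure_isSigmaFinite.Build _ _ _ plane_measure plane_measure_sigma_finite.

End PlaneMeasure.

Section Geometry.
Context {R : realType}.
Notation leb := (@lebesgue_measure R).

Lemma continuous_compact_bound (T : topologicalType) (K : set T) (f : T -> R) :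
  compact K -> continuous f -> exists2 M, 0 <= M & forall x, K x -> `|f x| <= M.
Proof.
move=> cK cf.
have : compact (f @` K) by apply: continuous_compact => //; exact: continuous_subspaceT.
move/compact_bounded => [M [_ MP]]; exists (`|M| + 1); first by rewrite addr_ge0.
move=> x Kx; apply: MP; last by exists x.
by rewrite (le_lt_trans (ler_norm M))// ltrDl.
Qed.

Lemma measurable_fun_cont2 (f : R * R -> R) : continuous f ->
  measurable_fun setT (f : measurableTypeR R * measurableTypeR R -> R).
Proof.
move=> cf; apply: (@measurable_fun_caratheodory R _ (measurableTypeR R) f) => [y|x].
  have cfy : continuous (fun x : R => f (x, y)) by apply: continuous_compose cf _; cont.
  exact: measurable_realfun.continuous_measurable_fun cfy.
exact: (@continuous_section R R R f x cf).
Qed.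

Lemma measurable_fun_cont3 (f : R * R * R -> R) : continuous f ->
  measurable_fun setT
    (f : measurableTypeR R * measurableTypeR R * measurableTypeR R -> R).
Proof.
move=> cf; apply: (@measurable_fun_caratheodory R _
  (measurableTypeR R * measurableTypeR R)%type f) => [y|x].
  have cfy : continuous (fun u : R * R => f (u, y)) by apply: continuous_compose cf _; cont.
  exact: measurable_fun_cont2 cfy.
exact: (@continuous_section (R * R)%type R R f x cf).
Qed.

Lemma Rintegral_rect (a b c d : R) (f : R * R -> R) : continuous f ->
  \int[(leb \x leb)%E]_(z in `[a, b] `*` `[c, d]) f z =
  segint a b (fun x => segint c d (fun y => f (x, y))).
Proof.
move=> cf.
have [||M _ fM] := @continuous_compact_bound _ (`[a, b] `*` `[c, d]) f.
- by apply: compact_setX; exact: segment_compact.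
- exact: cf.
apply: (@Rintegral_prod_segment R _ (measurableTypeR R) leb `[a, b] c d M f).
- by [].
- exact: lebesgue_segment_lty.
- exact: measurable_fun_cont2.
- by move=> x y xab ycd; apply: fM.
Qed.

Definition sphint (f : pt R -> R) : R :=
  segint 0 pi (fun th => segint 0 (2 * pi) (fun la => f (sphere_pt (th, la)) * sin th)).

Lemma sphere_integralE (f : pt R -> R) : continuous f -> sphere_integral f = sphint f.
Proof.
move=> cf; rewrite /sphere_integral.
rewrite (@Rintegral_rect 0 pi 0 (2 * pi) (fun z => f (sphere_pt z) * sin z.1))//.
apply: continuous_mul; last by cont.
by apply: continuous_compose cf _; apply: continuous_sphere_pt; cont.
Qed.

Let J2 (a b c d : R) (f : R * R -> R) :=
  segint a b (fun x => segint c d (fun y => f (x, y))).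

Lemma sphint_integrator : integrator sphint.
Proof.
apply: (@integrator_pull R _ _ (J2 0 pi 0 (2 * pi)) sphere_pt (fun z => sin z.1)).
- by apply: continuous_sphere_pt; cont.
- by cont.
- by apply: integrator_comp; exact: segint_integrator.
Qed.

Lemma commuting_sphint (Y : topologicalType) (J : (Y -> R) -> R) :
  integrator J -> commuting J sphint.
Proof.
move=> IJ.
apply: (@commuting_pull R _ _ _ J (J2 0 pi 0 (2 * pi)) sphere_pt (fun z => sin z.1)) => //.
- by apply: continuous_sphere_pt; cont.
- by cont.
- by apply: commuting_comp; first exact: segint_integrator; exact: commuting_segint.
Qed.

(** Stands for the integral over all of R^3: the integrands it is applied to carry a factor
    supported in a cube, and a bounded cube keeps the functional an integrator. *)
Definition boxint (N : R) (f : pt R -> R) : R :=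
  segint (- N) N (fun x => segint (- N) N (fun y => segint (- N) N (fun z =>
    f (pt_of (x, y, z))))).

Let J3 (N : R) (f : R * R * R -> R) :=
  J2 (- N) N (- N) N (fun u => segint (- N) N (fun z => f (u, z))).

Lemma boxint_integrator N : integrator (boxint N).
Proof.
rewrite (_ : boxint N = fun f => J3 N (fun y => f (pt_of y) * 1)).
  apply: (@integrator_pull R _ _ (J3 N) pt_of (fun=> 1)).
  - by apply: continuous_pt_of; cont.
  - by cont.
  - apply: integrator_comp; last exact: segint_integrator.
    by apply: integrator_comp; exact: segint_integrator.
apply/funext => f; rewrite /boxint /J3 /J2.
by do 3 (congr segint; apply/funext => ?); rewrite mulr1.
Qed.

Definition box (N : R) : set (pt R) := [set x | forall i, `|x 0 i| <= N].

Lemma compact_box N : compact (box N).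
Proof.
have := @rV_compact R 3 (fun=> `[- N, N]%classic) (fun=> @segment_compact R (- N) N).
by congr compact; apply/seteqP; split=> x xN i; have := xN i; rewrite /= in_itv/= ler_norml.
Qed.

Lemma compact_sub_box (K : set (pt R)) : compact K ->
  exists2 N, 0 < N & K `<=` [set x | forall i, `|x 0 i| < N].
Proof.
move=> cK; have [M [_ MP]] := compact_bounded cK.
have MK : forall x, K x -> `|x| <= `|M| + 1.
  by move=> x Kx; apply: MP => //; rewrite (le_lt_trans (ler_norm M))// ltrDl.
(* One more than the bound in [MK], because the cube is open. *)
exists (`|M| + 2) => [|x Kx i]; first by have := normr_ge0 M; lra.
have : `|x 0 i| <= `|x|.
  rewrite -[`|x|]/(mx_norm _) mx_normrE.
  exact: (@le_bigmax _ _ _ _ (fun ij : 'I_1 * 'I_3 => `|x ij.1 ij.2|) (0, i)).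
by have := MK _ Kx; lra.
Qed.

Let R2box (N : R) : set (measurableTypeR R * measurableTypeR R) :=
  `[- N, N] `*` `[- N, N].

Let R3box (N : R) : set (@R3 R) := R2box N `*` `[- N, N].

Let R3boxP N z : R3box N z <-> box N (pt_of z).
Proof.
split=> [[[/= z1 z2] z3]|zN].
  by apply: ord3_ind; rewrite row3E/= ler_norml; move: z1 z2 z3; rewrite !in_itv.
have := zN 0; have := zN 1; have := zN (1 + 1).
rewrite !row3E/= !ler_norml => z3 z2 z1.
by split; first split; rewrite /= in_itv.
Qed.

Let mR3box N : measurable (R3box N).
Proof. by apply: measurableX => //; exact: measurableX. Qed.

Lemma integral3_boxint N (f : pt R -> R) : continuous f ->
  (forall x, f x != 0 -> box N x) -> integral3 f = boxint N f.
Proof.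
move=> cf fN; rewrite /integral3 /leb3.
transitivity (\int[leb3]_(z in R3box N) f (pt_of z)).
  rewrite [RHS]Rintegral_mkcond; congr Rintegral; apply/funext => z; rewrite patchE.
  case: ifPn => // /negP zN; apply: contrapT => /eqP fz; apply: zN.
  by rewrite inE; apply/R3boxP; exact: fN.
have cg : continuous (fun z : R * R * R => f (pt_of z)).
  by apply: continuous_compose cf _; apply: continuous_pt_of; cont.
have [||M _ fM] := @continuous_compact_bound _ (box N) f => //; first exact: compact_box.
(* The measure does not change; written with [plane_measure] it carries the sigma-finite structure
   that Fubini's theorem requires. *)
transitivity (\int[(plane_measure \x leb)%E]_(z in R3box N) f (pt_of z)).
  by rewrite /Rintegral; congr fine; apply: eq_measure_integral.
rewrite (@Rintegral_prod_segment R _ _ plane_measure (R2box N) (- N) N M (fun z => f (pt_of z))).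
- transitivity (\int[(leb \x leb)%E]_(u in R2box N) segint (- N) N (fun z => f (pt_of (u, z)))).
    by rewrite /Rintegral; congr fine; apply: eq_measure_integral.
  apply: (@Rintegral_rect _ _ _ _ (fun u => segint (- N) N (fun z => f (pt_of (u, z))))).
  have [_ Ic _] := @segint_integrator R (- N) N.
  exact: (Ic _ (fun u : R * R * R => f (pt_of u))).
- exact: measurableX.
- exact: plane_measure_rect_lty.
- exact: measurable_fun_cont3.
- by move=> u y uN yN; apply: fM; apply/R3boxP.
Qed.

Lemma continuous_loc_integrable (f : pt R -> R) : continuous f -> loc_integrable f.
Proof.
move=> cf.
have cg : continuous (fun z : R * R * R => f (pt_of z)).
  by apply: continuous_compose cf _; apply: continuous_pt_of; cont.
split; first exact: measurable_fun_cont3.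
move=> K cK; have [N N0 KN] := compact_sub_box cK.
have [||M M0 fM] := @continuous_compact_bound _ (box N) f => //; first exact: compact_box.
apply: (@le_lt_trans _ _ (\int[leb3]_(z in R3box N) (M%:E)))%E.
  (* The preimage of [K] has not been shown to be measurable, so the two integrals are compared
     through the simple functions below their integrands. *)
  rewrite [leRHS]integral_mkcond [leLHS]integral_mkcond ge0_integralTE ?ge0_integralTE.
  - apply: le_ereal_sup => _ [h /= hf <-]; exists h => // z.
    apply: le_trans (hf z) _; rewrite !patchE; case: ifPn => zK.
      have zN : box N (pt_of z) by move=> i; apply/ltW/KN; exact: set_mem zK.
      rewrite mem_set; last exact/R3boxP.
      by rewrite lee_fin; exact: fM.
    by case: ifP => // _; rewrite lee_fin.
  - by move=> z; rewrite patchE; case: ifP => // _; rewrite lee_fin.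
  - by move=> z; rewrite patchE; case: ifP => // _; rewrite lee_fin.
rewrite integral_cst//; apply: lte_mul_pinfty => //.
rewrite /leb3 /R3box /= product_measure1E//=; last exact: measurableX.
apply: lte_mul_pinfty => //; last exact: lebesgue_segment_lty.
by rewrite ge0_fin_numE//; exact: plane_measure_rect_lty.
Qed.

End Geometry.

(** * Chain rule and Darboux's equation *)

Section ChainRule.
Context {R : realType}.

Lemma sum3 (V : zmodType) (f : 'I_3 -> V) : \sum_(i < 3) f i = f 0 + f 1 + f (1 + 1).
Proof.
rewrite !big_ord_recl big_ord0 addr0 addrA.
by congr (_ + f _ + f _); exact: val_inj.
Qed.

Lemma is_derive_continuous (f : R -> R) (s df : R) :
  is_derive s (1 : R) f df -> {for s, continuous f}.
Proof.
move=> fE; apply/differentiable_continuous/derivable1_diffP.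
exact: (@ex_derive _ _ _ _ _ _ _ fE).
Qed.

Lemma mean_value (f df : R -> R) (d : R) :
  (forall s, is_derive s (1 : R) f (df s)) ->
  exists2 c, `|c| <= `|d| & f d - f 0 = df c * d.
Proof.
move=> dfE.
have cf a b : {within `[a, b], continuous f}.
  by apply: continuous_subspaceT => s; exact: is_derive_continuous (dfE s).
have [d0|d0] := leP 0 d.
  have [c] := @MVT_segment R f df 0 d d0 (fun s _ => dfE s) (cf _ _).
  rewrite in_itv/= subr0 => /andP[c0 cd] ->; exists c => //.
  by rewrite !ger0_norm.
have [c] := @MVT_segment R f df d 0 (ltW d0) (fun s _ => dfE s) (cf _ _).
rewrite in_itv/= sub0r => /andP[dc c0] E; exists c; first by rewrite !ler0_norm ?lerN2// ltW.
by rewrite -opprB E mulrN opprK.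
Qed.

Lemma is_derive_axis (F : pt R -> R) (i : 'I_3) (x : pt R) (s : R) :
  (forall y, derivable F y (delta_mx 0 i)) ->
  is_derive s (1 : R) (fun s => F (x + s *: delta_mx 0 i))
    (partial i F (x + s *: delta_mx 0 i)).
Proof.
move=> dF.
have E : (fun h : R => h^-1 *: (((fun s => F (x + s *: delta_mx 0 i)) \o shift s) (h *: 1) -
      F (x + s *: delta_mx 0 i))) =
    (fun h : R => h^-1 *: ((F \o shift (x + s *: delta_mx 0 i)) (h *: delta_mx 0 i) -
      F (x + s *: delta_mx 0 i))).
  apply/funext => h /=; congr (_ *: (F _ - _)).
  by rewrite [_ *: 1]mulr1 scalerDl addrCA.
split; first by rewrite /derivable E; exact: dF.
by rewrite /partial /derive E.
Qed.

(** The path from [x] to [y] runs parallel to the three axes, with one intermediate point on each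
    leg. Only partial derivatives occur, as in [Ck], and no total differential. *)
Lemma mean_value3 (F : pt R -> R) (x y : pt R) :
  (forall i z, derivable F z (delta_mx 0 i)) ->
  exists xi : 'I_3 -> pt R,
    (forall i j, `|xi i 0 j - x 0 j| <= `|y 0 j - x 0 j|) /\
    F y - F x = \sum_(i < 3) partial i F (xi i) * (y 0 i - x 0 i).
Proof.
move=> dF.
pose e i : pt R := delta_mx 0 i; pose d i := y 0 i - x 0 i.
have mv i z : exists2 c, `|c| <= `|d i| &
    F (z + d i *: e i) - F z = partial i F (z + c *: e i) * d i.
  have [s|c cd E] := @mean_value (fun s => F (z + s *: e i))
    (fun s => partial i F (z + s *: e i)) (d i).
    exact: is_derive_axis.
  by exists c => //; rewrite -E scale0r addr0.
have [c0 h0 E0] := mv 0 x.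
have [c1 h1 E1] := mv 1 (x + d 0 *: e 0).
have [c2 h2 E2] := mv (1 + 1) (x + d 0 *: e 0 + d 1 *: e 1).
have yE : x + d 0 *: e 0 + d 1 *: e 1 + d (1 + 1) *: e (1 + 1) = y.
  by apply/rowP; apply: ord3_ind; rewrite !mxE/= /d; ring.
rewrite yE in E2.
exists (fun i => if i == 0 then x + c0 *: e 0 else
  if i == 1 then x + d 0 *: e 0 + c1 *: e 1
  else x + d 0 *: e 0 + d 1 *: e 1 + c2 *: e (1 + 1)); split; last first.
  by rewrite sum3 /= -E0 -E1 -E2; ring.
apply: ord3_ind => /=; apply: ord3_ind; rewrite !mxE/=.
all: rewrite ?(mulr0, mulr1, addr0) ?subrr ?normr0 ?normr_ge0//.
all: by rewrite [_ + _ - _]addrAC subrr add0r.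
Qed.

(** Continuity of the partial derivatives replaces total differentiability: the difference quotient
    is expanded at the intermediate points of [mean_value3], and these are squeezed to [g s]. *)
Lemma chain_rule (F : pt R -> R) (g : R -> pt R) (dg : 'I_3 -> R) (s : R) :
  Ck 1 F -> (forall i, is_derive s (1 : R) (fun t => g t 0 i) (dg i)) ->
  is_derive s (1 : R) (fun t => F (g t)) (\sum_(i < 3) partial i F (g s) * dg i).
Proof.
move=> [cF dF] dgE.
have [xi xiP] := choice (fun h : R => @mean_value3 F (g s) (g (h + s)) (fun i => (dF i).1)).
have gh j : g (h + s) 0 j @[h --> (0 : R)^'] --> g s 0 j.
  apply: (@cvg_comp _ _ _ (fun h => h + s) (fun t => g t 0 j) _ (nbhs s)).
    have hs : h + s @[h --> (0 : R)] --> 0 + s by apply: cvgD; [exact: cvg_id|exact: cvg_cst].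
    by rewrite add0r in hs; exact: cvg_within_filter hs.
  exact: is_derive_continuous (dgE j).
have q i : h^-1 * (g (h + s) 0 i - g s 0 i) @[h --> (0 : R)^'] --> dg i.
  have := @ex_derive _ _ _ _ _ _ _ (dgE i); rewrite /derivable => /cvg_ex[l ql].
  have := @derive_val _ _ _ _ _ _ _ (dgE i); rewrite /derive (cvg_lim _ ql)// => <-.
  apply: cvg_trans ql; apply: near_eq_cvg; near=> h.
  by rewrite /= [h *: 1]mulr1.
have xic i : xi h i @[h --> (0 : R)^'] --> g s.
  apply/cvgrPdist_lt => /= e e0.
  have : \forall h \near (0 : R)^', forall j, `|g s 0 j - g (h + s) 0 j| < e.
    by apply: filter_forall => j; move/cvgrPdist_lt: (gh j); exact.
  apply: filterS => h hj; rewrite -[`|_|]/(mx_norm _) mx_normrE.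
  apply/bigmax_ltP; split=> // -[k j] _; rewrite !mxE ord1 /= distrC.
  by apply: le_lt_trans (hj j); rewrite [leRHS]distrC; exact: (xiP h).1.
have L : h^-1 *: (F (g (h + s)) - F (g s)) @[h --> (0 : R)^'] -->
    \sum_(i < 3) partial i F (g s) * dg i.
  have cE i : partial i F (xi h i) * (h^-1 * (g (h + s) 0 i - g s 0 i)) @[h --> (0 : R)^'] -->
      partial i F (g s) * dg i.
    apply: cvgM (q i).
    by apply: (@cvg_comp _ _ _ (fun h => xi h i) (partial i F) _ _ _ (xic i)); exact: (dF i).2.1.
  rewrite sum3; apply: cvg_trans (cvgD (cvgD (cE 0) (cE 1)) (cE (1 + 1))).
  apply: near_eq_cvg; near=> h.
  rewrite (xiP h).2 sum3 /GRing.scale !fctE/=; ring.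
have E : (fun h : R => h^-1 *: (((fun t => F (g t)) \o shift s) (h *: 1) - F (g s))) =
    (fun h : R => h^-1 *: (F (g (h + s)) - F (g s))).
  by apply/funext => h /=; rewrite [_ *: 1]mulr1.
split; first by rewrite /derivable E; apply/cvg_ex; eexists; exact: L.
by rewrite /derive E; exact: cvg_lim L.
Unshelve. all: by end_near. Qed.

End ChainRule.

Section Darboux.
Context {R : realType}.

Lemma is_derive_mulf (f g : R -> R) (s df dg : R) :
  is_derive s (1 : R) f df -> is_derive s (1 : R) g dg ->
  is_derive s (1 : R) (fun t => f t * g t) (df * g s + f s * dg).
Proof.
move=> fE gE; have := @is_deriveM _ _ f g s 1 df dg fE gE.
by rewrite /GRing.scale/= addrC [g s * df]mulrC.
Qed.

Lemma is_derive_addf (f g : R -> R) (s df dg : R) :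
  is_derive s (1 : R) f df -> is_derive s (1 : R) g dg ->
  is_derive s (1 : R) (fun t => f t + g t) (df + dg).
Proof. by move=> fE gE; exact: is_deriveD. Qed.

Lemma is_derive_cstf (k s : R) : is_derive s (1 : R) (fun=> k) 0.
Proof. exact: is_derive_cst. Qed.

Lemma is_derive_idf (s : R) : is_derive s (1 : R) (fun t : R => t) 1.
Proof. exact: is_derive_id. Qed.

Lemma is_derive_sum3 (f : 'I_3 -> R -> R) (df : 'I_3 -> R) (s : R) :
  (forall i, is_derive s (1 : R) (f i) (df i)) ->
  is_derive s (1 : R) (fun t => \sum_(i < 3) f i t) (\sum_(i < 3) df i).
Proof.
move=> fE; rewrite sum3; under eq_fun do rewrite sum3.
by apply: is_derive_addf => //; exact: is_derive_addf.
Qed.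

Lemma is_derive_eqf (f : R -> R) (s df df' : R) :
  is_derive s (1 : R) f df -> df = df' -> is_derive s (1 : R) f df'.
Proof. by move=> fE <-. Qed.

Definition laplacian (F : pt R -> R) (x : pt R) : R := \sum_(i < 3) partial i (partial i F) x.

(* [wmean F] is the u_F of the header and [dwmean F] its derivative. *)
Definition wmean (F : pt R -> R) (s : R) : R :=
  s * ((4 * pi)^-1 * sphint (fun y => F (s *: y))).

Definition dwmean (F : pt R -> R) (s : R) : R :=
  (4 * pi)^-1 *
  sphint (fun y => F (s *: y) + s * \sum_(i < 3) partial i F (s *: y) * y 0 i).

Lemma is_derive_ray (F : pt R -> R) (s : R) (y : pt R) : Ck 1 F ->
  is_derive s (1 : R) (fun t => F (t *: y)) (\sum_(i < 3) partial i F (s *: y) * y 0 i).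
Proof.
move=> CF; apply: (@chain_rule R F (fun t => t *: y) (fun i => y 0 i)) => // i.
under eq_fun do rewrite mxE.
apply: is_derive_eqf (is_derive_mulf (is_derive_idf s) (is_derive_cstf (y 0 i) s)) _.
by rewrite mul1r mulr0 addr0.
Qed.

Lemma wmean_is_derive (F : pt R -> R) (s : R) : Ck 1 F ->
  is_derive s (1 : R) (wmean F) (dwmean F s).
Proof.
move=> CF; have [cF dF] := CF.
have cD i : continuous (partial i F) := (dF i).2.1.
pose G (u : R * pt R) := u.1 * F (u.1 *: u.2).
pose dG (u : R * pt R) :=
  F (u.1 *: u.2) + u.1 * \sum_(i < 3) partial i F (u.1 *: u.2) * u.2 0 i.
have cG : continuous G by rewrite /G; cont.
have cdG : continuous dG by rewrite /dG; cont.
have -> : wmean F = (fun t => (4 * pi)^-1 * sphint (fun y => G (t, y))).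
  apply/funext => t; rewrite /wmean /G /= integratorZ;
    [by rewrite mulrCA|exact: sphint_integrator|].
  by cont.
have := is_derive_mulf (is_derive_cstf (4 * pi)^-1 s)
  (@integrator_is_derive R _ sphint G dG s sphint_integrator cG cdG _).
move=> D; apply: is_derive_eqf (D _) _; last by rewrite mul0r add0r.
move=> t y; apply: is_derive_eqf (is_derive_mulf (is_derive_idf t) (is_derive_ray t y CF)) _.
by rewrite mul1r.
Qed.

(* [polar_vec] and [azimuth_vec] are e_th and e_la; the derivative of [sphere_pt] in
   the longitude is [sin z.1 *: azimuth_vec z], and that of [azimuth_vec] is [axial_vec]. *)
Definition polar_vec (z : R * R) : pt R :=
  \row_i [:: cos z.1 * cos z.2; cos z.1 * sin z.2; - sin z.1]`_i.

Definition azimuth_vec (z : R * R) : pt R := \row_i [:: - sin z.2; cos z.2; 0]`_i.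

Definition axial_vec (z : R * R) : pt R := \row_i [:: - cos z.2; - sin z.2; 0]`_i.

Lemma is_derive_sphere_pt_colatitude th la i :
  is_derive th (1 : R) (fun t => sphere_pt (t, la) 0 i) (polar_vec (th, la) 0 i).
Proof.
move: i; apply: ord3_ind; rewrite row3E/=; under eq_fun do rewrite row3E/=.
- apply: is_derive_eqf (is_derive_mulf (is_derive_sin th) (is_derive_cstf _ th)) _; ring.
- apply: is_derive_eqf (is_derive_mulf (is_derive_sin th) (is_derive_cstf _ th)) _; ring.
- exact: is_derive_cos.
Qed.

Lemma is_derive_polar_vec_colatitude th la i :
  is_derive th (1 : R) (fun t => polar_vec (t, la) 0 i) (- sphere_pt (th, la) 0 i).
Proof.
move: i; apply: ord3_ind; rewrite row3E/=; under eq_fun do rewrite row3E/=.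
- apply: is_derive_eqf (is_derive_mulf (is_derive_cos th) (is_derive_cstf _ th)) _; ring.
- apply: is_derive_eqf (is_derive_mulf (is_derive_cos th) (is_derive_cstf _ th)) _; ring.
- under eq_fun do rewrite -mulN1r.
  apply: is_derive_eqf (is_derive_mulf (is_derive_cstf _ th) (is_derive_sin th)) _; ring.
Qed.

Lemma is_derive_sphere_pt_longitude th la i :
  is_derive la (1 : R) (fun t => sphere_pt (th, t) 0 i) (sin th * azimuth_vec (th, la) 0 i).
Proof.
move: i; apply: ord3_ind; rewrite row3E/=; under eq_fun do rewrite row3E/=.
- apply: is_derive_eqf (is_derive_mulf (is_derive_cstf _ la) (is_derive_cos la)) _; ring.
- apply: is_derive_eqf (is_derive_mulf (is_derive_cstf _ la) (is_derive_sin la)) _; ring.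
- by apply: is_derive_eqf (is_derive_cstf _ la) _; rewrite mulr0.
Qed.

Lemma is_derive_azimuth_vec_longitude th la i :
  is_derive la (1 : R) (fun t => azimuth_vec (th, t) 0 i) (axial_vec (th, la) 0 i).
Proof.
move: i; apply: ord3_ind; rewrite row3E/=; under eq_fun do rewrite row3E/=.
- under eq_fun do rewrite -mulN1r.
  apply: is_derive_eqf (is_derive_mulf (is_derive_cstf _ la) (is_derive_sin la)) _; ring.
- exact: is_derive_cos.
- exact: is_derive_cstf.
Qed.

Lemma continuous_vecs :
  [/\ continuous polar_vec, continuous azimuth_vec & continuous axial_vec].
Proof.
split.
- by apply: (@continuous_row3 _ _ (fun z => cos z.1 * cos z.2)
    (fun z => cos z.1 * sin z.2) (fun z => - sin z.1)); cont.
- by apply: (@continuous_row3 _ _ (fun z => - sin z.2) (fun z => cos z.2) (fun=> 0)); cont.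
- by apply: (@continuous_row3 _ _ (fun z => - cos z.2) (fun z => - sin z.2) (fun=> 0)); cont.
Qed.

(** The pointwise identity of the overview with its derivatives expanded: [g] and [h] stand for the
    first and second partial derivatives of F at s y. What remains is polynomial in the sines and
    cosines of the two angles. *)
Lemma spherical_laplacian (s : R) (z : R * R) (g : 'I_3 -> R) (h : 'I_3 -> 'I_3 -> R) :
  s * (\sum_(i < 3) h i i) * sin z.1 =
  (2 * \sum_(i < 3) g i * sphere_pt z 0 i +
   s * \sum_(i < 3) (\sum_(j < 3) h i j * sphere_pt z 0 j) * sphere_pt z 0 i) * sin z.1
  + ((cos z.1 * \sum_(i < 3) g i * polar_vec z 0 i +
      sin z.1 * \sum_(i < 3) ((\sum_(j < 3) h i j * (s * polar_vec z 0 j)) * polar_vec z 0 i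
         + g i * - sphere_pt z 0 i))
  + \sum_(i < 3) ((\sum_(j < 3) h i j * (s * (sin z.1 * azimuth_vec z 0 j))) * azimuth_vec z 0 i
         + g i * axial_vec z 0 i)).
Proof.
rewrite !sum3 !row3E/=.
have := cos2Dsin2 z.1; have := cos2Dsin2 z.2.
move: (cos z.1) (sin z.1) (cos z.2) (sin z.2) => d a b c V U.
apply/eqP; rewrite eq_sym -subr_eq0; apply/eqP.
(* The difference lies in the ideal generated by the two relations cos^2 + sin^2 - 1; these are its
   cofactors. *)
transitivity ((d ^+ 2 + a ^+ 2 - 1) * (s * a * (h 0 0 * b ^+ 2 + h 1 1 * c ^+ 2
    + h (1 + 1) (1 + 1) + (h 0 1 + h 1 0) * b * c) + g 0 * b + g 1 * c) +
  (b ^+ 2 + c ^+ 2 - 1) * (s * a * (h 0 0 + h 1 1))); first by ring.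
by rewrite U V subrr !mul0r addr0.
Qed.

Lemma sphint_laplacian (F : pt R -> R) (s : R) : Ck 2 F ->
  sphint (fun y => 2 * (\sum_(i < 3) partial i F (s *: y) * y 0 i) +
    s * \sum_(i < 3) (\sum_(j < 3) partial j (partial i F) (s *: y) * y 0 j) * y 0 i) =
  sphint (fun y => s * laplacian F (s *: y)).
Proof.
move=> [cF dF]; have C1F i := (dF i).2.
have c1 i : continuous (partial i F) := (C1F i).1.
have c2 i j : continuous (partial j (partial i F)) := ((C1F i).2 j).2.1.
have [cp ca cx] := continuous_vecs.
pose f z := (2 * (\sum_(i < 3) partial i F (s *: sphere_pt z) * sphere_pt z 0 i) +
  s * \sum_(i < 3) (\sum_(j < 3) partial j (partial i F) (s *: sphere_pt z) * sphere_pt z 0 j)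
    * sphere_pt z 0 i) * sin z.1.
pose A z := sin z.1 * \sum_(i < 3) partial i F (s *: sphere_pt z) * polar_vec z 0 i.
pose B z := \sum_(i < 3) partial i F (s *: sphere_pt z) * azimuth_vec z 0 i.
pose dA z := cos z.1 * (\sum_(i < 3) partial i F (s *: sphere_pt z) * polar_vec z 0 i) +
  sin z.1 * \sum_(i < 3)
    ((\sum_(j < 3) partial j (partial i F) (s *: sphere_pt z) * (s * polar_vec z 0 j)) *
       polar_vec z 0 i + partial i F (s *: sphere_pt z) * - sphere_pt z 0 i).
pose dB z := \sum_(i < 3)
  ((\sum_(j < 3) partial j (partial i F) (s *: sphere_pt z) *
      (s * (sin z.1 * azimuth_vec z 0 j))) * azimuth_vec z 0 i +
   partial i F (s *: sphere_pt z) * axial_vec z 0 i).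
have cf : continuous f by rewrite /f; cont.
have cdA : continuous dA by rewrite /dA; cont.
have cdB : continuous dB by rewrite /dB; cont.
have dAE th la : is_derive th (1 : R) (fun t => A (t, la)) (dA (th, la)).
  have D i : is_derive th (1 : R) (fun t => partial i F (s *: sphere_pt (t, la)))
      (\sum_(j < 3) partial j (partial i F) (s *: sphere_pt (th, la)) *
        (s * polar_vec (th, la) 0 j)).
    apply: (@chain_rule R (partial i F) (fun t => s *: sphere_pt (t, la))) => // j.
    under eq_fun do rewrite mxE.
    apply: is_derive_eqf (is_derive_mulf (is_derive_cstf s th)
      (is_derive_sphere_pt_colatitude th la j)) _.
    by rewrite mul0r add0r.
  exact: (is_derive_mulf (is_derive_sin th) (is_derive_sum3 (fun i =>
    is_derive_mulf (D i) (is_derive_polar_vec_colatitude th la i)))).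
have dBE th la : is_derive la (1 : R) (fun t => B (th, t)) (dB (th, la)).
  have D i : is_derive la (1 : R) (fun t => partial i F (s *: sphere_pt (th, t)))
      (\sum_(j < 3) partial j (partial i F) (s *: sphere_pt (th, la)) *
        (s * (sin th * azimuth_vec (th, la) 0 j))).
    apply: (@chain_rule R (partial i F) (fun t => s *: sphere_pt (th, t))) => // j.
    under eq_fun do rewrite mxE.
    apply: is_derive_eqf (is_derive_mulf (is_derive_cstf s la)
      (is_derive_sphere_pt_longitude th la j)) _.
    by rewrite mul0r add0r.
  exact: (is_derive_sum3 (fun i =>
    is_derive_mulf (D i) (is_derive_azimuth_vec_longitude th la i))).
have pi0 : (0 : R) <= pi by exact: pi_ge0.
pose J (g : R * R -> R) := segint 0 pi (fun th => segint 0 (2 * pi) (fun la => g (th, la))).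
have IJ : integrator J by apply: integrator_comp; exact: segint_integrator.
(* The colatitude is integrated first, after an exchange of the two integrals; [A] vanishes at both
   poles because of its factor [sin z.1]. *)
have A0 : J dA = 0.
  rewrite /J (commuting_segint _ _ (@segint_integrator R 0 pi) cdA).
  rewrite -[RHS](integrator_cst0 (@segint_integrator R 0 (2 * pi))).
  apply: segint_eq => la _.
  rewrite (@segint_FTC R 0 pi (fun th => dA (th, la)) (fun th => A (th, la))) //.
    by rewrite /A /= sinpi sin0 !mul0r subrr.
  by apply: continuous_compose cdA _; cont.
(* [B] has period 2 pi in the longitude, so its end values cancel. *)
have B0 : J dB = 0.
  rewrite -[RHS](integrator_cst0 (@segint_integrator R 0 pi)); apply: segint_eq => th _.
  rewrite (@segint_FTC R 0 (2 * pi) (fun la => dB (th, la)) (fun la => B (th, la))) //.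
  - rewrite /B /sphere_pt /azimuth_vec /= mulr_natl sin2pi cos2pi sin0 cos0.
    exact: subrr.
  - by rewrite mulr_ge0.
  - exact: (@continuous_section R R R dB th cdB).
have E : J f = J (fun z => f z + (dA z + dB z)).
  have -> := integratorD IJ cf (continuous_add cdA cdB).
  by have -> := integratorD IJ cdA cdB; rewrite A0 B0 !addr0.
transitivity (J f); first by [].
rewrite E; congr segint; apply/funext => th; congr segint; apply/funext => la.
symmetry; exact: (spherical_laplacian s (th, la)
  (fun i => partial i F (s *: sphere_pt (th, la)))
  (fun i j => partial j (partial i F) (s *: sphere_pt (th, la)))).
Qed.

(** Differentiating s F(s y) twice in s leaves 2 F_r + s F_rr, with F_r and F_rr the radial
    derivatives at s y; this is the integrand that [sphint_laplacian] converts. *)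
Lemma dwmean_is_derive (F : pt R -> R) (s : R) : Ck 2 F ->
  is_derive s (1 : R) (dwmean F) (wmean (laplacian F) s).
Proof.
move=> CF; have [cF dF] := CF; have C1F i := (dF i).2.
have CF1 : Ck 1 F by split=> // i; have [? [? _]] := dF i.
have c1 i : continuous (partial i F) := (C1F i).1.
have c2 i j : continuous (partial j (partial i F)) := ((C1F i).2 j).2.1.
pose G (u : R * pt R) :=
  F (u.1 *: u.2) + u.1 * \sum_(i < 3) partial i F (u.1 *: u.2) * u.2 0 i.
pose dG (u : R * pt R) := 2 * (\sum_(i < 3) partial i F (u.1 *: u.2) * u.2 0 i) +
  u.1 * \sum_(i < 3) (\sum_(j < 3) partial j (partial i F) (u.1 *: u.2) * u.2 0 j) * u.2 0 i.
have cG : continuous G by rewrite /G; cont.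
have cdG : continuous dG by rewrite /dG; cont.
have D : forall t y, is_derive t (1 : R) (fun t => G (t, y)) (dG (t, y)).
  move=> t y; apply: is_derive_eqf (is_derive_addf (is_derive_ray t y CF1)
    (is_derive_mulf (is_derive_idf t)
      (is_derive_sum3 (fun i => is_derive_mulf (is_derive_ray t y (C1F i))
        (is_derive_cstf (y 0 i) t))))) _.
  under [X in _ + (_ + _ * X)]eq_bigr do rewrite mulr0 addr0.
  by rewrite mul1r addrA -mulr2n -mulr_natl.
apply: is_derive_eqf (is_derive_mulf (is_derive_cstf (4 * pi)^-1 s)
  (@integrator_is_derive R _ sphint G dG s sphint_integrator cG cdG D)) _.
rewrite mul0r add0r /wmean mulrCA; congr (_ * _).
rewrite -integratorZ; [|exact: sphint_integrator|by rewrite /laplacian; cont].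
exact: sphint_laplacian.
Qed.

Lemma sphint_cst (k : R) : sphint (fun=> k) = 4 * pi * k.
Proof.
have pi0 : (0 : R) <= pi by exact: pi_ge0.
rewrite /sphint (_ : (fun th : R => _) = (fun th => 2 * pi * k * sin th)); last first.
  by apply/funext => th; rewrite segint_cst ?subr0; [ring|rewrite mulr_ge0].
have D th : is_derive th (1 : R) (fun th => - (2 * pi * k) * cos th) (2 * pi * k * sin th).
  apply: is_derive_eqf (is_derive_mulf (is_derive_cstf _ th) (is_derive_cos th)) _.
  by ring.
rewrite (segint_FTC pi0 _ D); first by rewrite cospi cos0; ring.
by cont.
Qed.

Lemma dwmean0 (F : pt R -> R) : dwmean F 0 = F 0.
Proof.
rewrite /dwmean (_ : (fun y => _) = (fun=> F 0)); last first.
  by apply/funext => y; rewrite scale0r mul0r addr0.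
rewrite sphint_cst mulKf// mulf_neq0//; exact/lt0r_neq0/pi_gt0.
Qed.

Lemma continuous_wmean (F : pt R -> R) : continuous F -> continuous (wmean F).
Proof.
move=> cF; have [_ Sc _] := @sphint_integrator R.
have cS : continuous (fun s : R => sphint (fun y => F (s *: y))).
  by apply: (Sc R (fun u : R * pt R => F (u.1 *: u.2))); cont.
by rewrite /wmean; cont.
Qed.

(** The integrated form matches the formula for p: a value plus an integral of weighted means
    collapses into one derivative. *)
Lemma darboux (F : pt R -> R) (s : R) : Ck 2 F -> 0 <= s ->
  F 0 + segint 0 s (wmean (laplacian F)) = dwmean F s.
Proof.
move=> CF s0; have c2 i : continuous (partial i (partial i F)).
  exact: ((CF.2 i).2.2 i).2.1.
rewrite (segint_FTC s0 _ (fun t => dwmean_is_derive t CF)) ?dwmean0 ?subrKC//.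
by apply: continuous_wmean; rewrite /laplacian; cont.
Qed.

End Darboux.

(** * Correlations with test functions *)

Section Correlation.
Context {R : realType}.
Implicit Types (f g phi : pt R -> R) (N s : R) (i : 'I_3).

(** The strict inequality puts the support in the open cube, so that [phi] vanishes on the faces and
    integration by parts has no boundary terms. *)
Definition inside N phi := supp phi `<=` [set x : pt R | forall i, `|x 0 i| < N].

Lemma inside_partial N phi i : inside N phi -> inside N (partial i phi).
Proof. by move=> h; apply: subset_trans h; exact: supp_partialS. Qed.

Lemma inside_eq0 N phi (x : pt R) i : inside N phi -> N <= `|x 0 i| -> phi x = 0.
Proof.
move=> h Nx; apply: contrapT => /eqP px.
have sx : supp phi x by apply: subset_closure.
by have := h x sx i; rewrite ltNge Nx.
Qed.

(** Integrating first in direction [i] leaves only values of [u] on two opposite faces. *)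
Lemma boxint_partial N (u : pt R -> R) i : 0 <= N -> Ck 1 u ->
  (forall (x : pt R) j, N <= `|x 0 j| -> u x = 0) -> boxint N (partial i u) = 0.
Proof.
move=> N0 Cu u0; have [cu dudv] := Cu.
have cdu : continuous (partial i u) := (dudv i).2.1.
have NN : - N <= N by lra.
(* [g] runs along a line in direction [i], parametrized by its own i-th coordinate. *)
have z1 (g : R -> pt R) : (forall s j, g s 0 j = (if j == i then s else g 0 0 j)) ->
    continuous g -> segint (- N) N (fun s => partial i u (g s)) = 0.
  move=> gE cg.
  have D s : is_derive s (1 : R) (fun t => u (g t)) (partial i u (g s)).
    apply: is_derive_eqf (@chain_rule R u g (fun j => (j == i)%:R) s Cu _) _.
      move=> j; under eq_fun do rewrite gE.
      by case: eqP => _; [exact: is_derive_idf|exact: is_derive_cstf].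
    rewrite (bigD1 i)//= eqxx mulr1 big1 ?addr0// => j ji.
    by rewrite (negbTE ji) mulr0.
  rewrite (segint_FTC NN _ D); last exact: continuous_compose.
  by rewrite (u0 _ i) ?(u0 (g (- N)) i) ?subrr// gE eqxx ?normrN ler_norm.
pose f (w : R * R * R) := partial i u (pt_of w).
have cf : continuous f by rewrite /f; cont.
pose S := segint (R := R) (- N) N.
have IS : integrator S by exact: segint_integrator.
have S0 : S (fun=> 0) = 0 by exact: integrator_cst0.
have swap (F : R * R -> R) : continuous F ->
    S (fun x => S (fun y => F (x, y))) = S (fun y => S (fun x => F (x, y))).
  exact: commuting_segint.
have g0 b c : continuous (fun a => pt_of (a, b, c)) by cont.
have g1 a c : continuous (fun b => pt_of (a, b, c)) by cont.
have g2 a b : continuous (fun c => pt_of (a, b, c)) by cont.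
(* The i-th integral has to become the innermost one: this takes two exchanges for the first
   coordinate, one for the second and none for the third. *)
rewrite /boxint -/S; case: (ord3_ind (P := fun i => i = 0 \/ i = 1 \/ i = 1 + 1) _ _ _ i);
  [by left|by right; left|by right; right| |].
  move=> iE; transitivity (S (fun y => S (fun x => S (fun z => f (x, y, z))))).
    have [_ Sc _] := IS.
    exact: (swap (fun u => S (fun z => f (u, z))) (Sc _ f cf)).
  rewrite -[RHS]S0; congr S; apply/funext => y.
  transitivity (S (fun z => S (fun x => f (x, y, z)))).
    by apply: (swap (fun u => f (u.1, y, u.2))); rewrite /f; cont.
  rewrite -[RHS]S0; congr S; apply/funext => z.
  apply: (z1 (fun x => pt_of (x, y, z))) => // s; rewrite iE; apply: ord3_ind;
    by rewrite /pt_of !row3E.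
case=> iE.
  rewrite -[RHS]S0; congr S; apply/funext => x.
  transitivity (S (fun z => S (fun y => f (x, y, z)))).
    by apply: (swap (fun u => f (x, u.1, u.2))); rewrite /f; cont.
  rewrite -[RHS]S0; congr S; apply/funext => z.
  apply: (z1 (fun y => pt_of (x, y, z))) => // s; rewrite iE; apply: ord3_ind;
    by rewrite /pt_of !row3E.
rewrite -[RHS]S0; congr S; apply/funext => x; rewrite -[RHS]S0; congr S; apply/funext => y.
apply: (z1 (fun z => pt_of (x, y, z))) => // s; rewrite iE; apply: ord3_ind;
  by rewrite /pt_of !row3E.
Qed.

(** The H_g of the overview, as soon as the cube contains the support of [phi]. *)
Definition corr N g phi (z : pt R) : R := boxint N (fun x => g (x + z) * phi x).

Lemma continuous_corr N g phi : continuous g -> continuous phi -> continuous (corr N g phi).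
Proof.
move=> cg cphi; have [_ Bc _] := @boxint_integrator R N.
by apply: (Bc _ (fun u : pt R * pt R => g (u.2 + u.1) * phi u.2)); cont.
Qed.

Lemma derivable_axis (F : pt R -> R) (z : pt R) i (l : R) :
  is_derive 0 (1 : R) (fun s => F (z + s *: delta_mx 0 i)) l ->
  derivable F z (delta_mx 0 i) /\ partial i F z = l.
Proof.
move=> D.
have E : (fun h : R => h^-1 *: (((fun s => F (z + s *: delta_mx 0 i)) \o shift 0) (h *: 1) -
      F (z + 0 *: delta_mx 0 i))) =
    (fun h : R => h^-1 *: ((F \o shift z) (h *: delta_mx 0 i) - F z)).
  apply/funext => h /=; rewrite scale0r !addr0; congr (_ *: (F _ - _)).
  by rewrite [_ *: 1]mulr1 addrC.
have := @ex_derive _ _ _ _ _ _ _ D; have := @derive_val _ _ _ _ _ _ _ D.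
by rewrite /derivable /partial /derive E.
Qed.

Lemma corr_partial N g phi i : Ck 1 g -> continuous phi ->
  (forall z, derivable (corr N g phi) z (delta_mx 0 i)) /\
  partial i (corr N g phi) = corr N (partial i g) phi.
Proof.
move=> [cg dg] cphi; have cdg : continuous (partial i g) := (dg i).2.1.
suff D z : is_derive 0 (1 : R) (fun s => corr N g phi (z + s *: delta_mx 0 i))
    (corr N (partial i g) phi z).
  split=> [z|]; first exact: (derivable_axis (D z)).1.
  by apply/funext => z; exact: (derivable_axis (D z)).2.
pose F (u : R * pt R) := g (u.2 + (z + u.1 *: delta_mx 0 i)) * phi u.2.
pose dF (u : R * pt R) := partial i g (u.2 + (z + u.1 *: delta_mx 0 i)) * phi u.2.
have cF : continuous F by rewrite /F; cont.
have cdF : continuous dF by rewrite /dF; cont.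
have DF s x : is_derive s (1 : R) (fun s => F (s, x)) (dF (s, x)).
  have A := is_derive_mulf (@is_derive_axis R g i (x + z) s (dg i).1) (is_derive_cstf (phi x) s).
  have -> : (fun s => F (s, x)) = (fun s => g (x + z + s *: delta_mx 0 i) * phi x).
    by apply/funext => r; rewrite /F /= addrA.
  by apply: is_derive_eqf A _; rewrite mulr0 addr0 /dF /= addrA.
apply: is_derive_eqf (@integrator_is_derive R _ (boxint N) F dF 0
  (boxint_integrator N) cF cdF DF) _.
by rewrite /corr /dF /= scale0r addr0.
Qed.

Lemma derivable_mul_partial f g i x :
  derivable f x (delta_mx 0 i) -> derivable g x (delta_mx 0 i) ->
  derivable (fun y => f y * g y) x (delta_mx 0 i) /\
  partial i (fun y => f y * g y) x = partial i f x * g x + f x * partial i g x.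
Proof.
move=> df dg.
have E : (fun y => f y * g y) = f * g by apply/funext.
rewrite E; split; first exact: (@derivableM _ _ f g x _ df dg).
rewrite /partial; have -> := deriveM df dg.
by rewrite /GRing.scale/= addrC [g x * _]mulrC.
Qed.

Lemma partial_translate f i (z x : pt R) :
  (forall y, derivable f y (delta_mx 0 i)) ->
  derivable (fun y => f (y + z)) x (delta_mx 0 i) /\
  partial i (fun y => f (y + z)) x = partial i f (x + z).
Proof.
move=> df; apply: derivable_axis.
have := @is_derive_axis R f i (x + z) 0 df; rewrite scale0r addr0.
congr is_derive; apply/funext => s; congr f; rewrite -!addrA; congr (_ + _); exact: addrC.
Qed.

(** The two sides differ by the box integral of the partial derivative of g(x + z) phi(x), a
    function of x that vanishes on and outside the faces. *)
Lemma corr_by_parts N g phi i : 0 <= N -> Ck 1 g -> Ck 1 phi -> inside N phi ->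
  corr N (partial i g) phi = (fun z => - corr N g (partial i phi) z).
Proof.
move=> N0 [cg dg] [cphi dphi] hphi; apply/funext => z.
have cdg j : continuous (partial j g) := (dg j).2.1.
have cdphi j : continuous (partial j phi) := (dphi j).2.1.
apply/eqP; rewrite -subr_eq0 opprK; apply/eqP.
pose u x := g (x + z) * phi x.
have uD j x : derivable u x (delta_mx 0 j) /\
    partial j u x = partial j g (x + z) * phi x + g (x + z) * partial j phi x.
  have [d1 e1] := @partial_translate g j z x (dg j).1.
  have [d2 e2] := @derivable_mul_partial (fun y => g (y + z)) phi j x d1 ((dphi j).1 x).
  by split; [exact: d2|rewrite e2 e1].
have duE j : partial j u = (fun x => partial j g (x + z) * phi x + g (x + z) * partial j phi x).
  by apply/funext => x; exact: (uD j x).2.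
rewrite /corr -(integratorD (boxint_integrator N)) -?duE; last 2 first.
- by cont.
- by cont.
apply: boxint_partial => //.
  split; first by rewrite /u; cont.
  move=> j; split; first by move=> x; exact: (uD j x).1.
  by split=> //; rewrite duE; cont.
by move=> x j Nx; rewrite /u (inside_eq0 hphi Nx) mulr0.
Qed.

Lemma integrator_sum (Y : topologicalType) (J : (Y -> R) -> R) n (f : 'I_n -> Y -> R) :
  integrator J -> (forall k, continuous (f k)) ->
  J (fun y => \sum_(k < n) f k y) = \sum_(k < n) J (f k).
Proof.
move=> IJ; elim: n f => [|n IH] f cf.
  by rewrite big_ord0 -[RHS](integrator_cst0 IJ); congr J; apply/funext => y; rewrite big_ord0.
have cf' k : continuous (f (widen_ord (leqnSn n) k)) by exact: cf.
rewrite big_ord_recr/= -IH// -(integratorD IJ (continuous_bigsum cf') (cf ord_max)).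
by congr J; apply/funext => y; rewrite big_ord_recr.
Qed.

Lemma corr_sumr N n g (phi : 'I_n -> pt R -> R) z :
  continuous g -> (forall k, continuous (phi k)) ->
  corr N g (fun x => \sum_(k < n) phi k x) z = \sum_(k < n) corr N g (phi k) z.
Proof.
move=> cg cphi; rewrite /corr -(integrator_sum (boxint_integrator N)); last first.
  by move=> k; cont.
by congr boxint; apply/funext => x; rewrite mulr_sumr.
Qed.

Lemma corr_suml N n (g : 'I_n -> pt R -> R) phi z :
  continuous phi -> (forall k, continuous (g k)) ->
  corr N (fun x => \sum_(k < n) g k x) phi z = \sum_(k < n) corr N (g k) phi z.
Proof.
move=> cphi cg; rewrite /corr -(integrator_sum (boxint_integrator N)); last first.
  by move=> k; cont.
by congr boxint; apply/funext => x; rewrite mulr_suml.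
Qed.

Lemma partial_opp f i : (forall x, derivable f x (delta_mx 0 i)) ->
  (forall x, derivable (fun y => - f y) x (delta_mx 0 i)) /\
  partial i (fun y => - f y) = (fun x => - partial i f x).
Proof.
move=> df; split=> [x|]; first exact: derivableN.
by apply/funext => x; rewrite /partial -deriveN.
Qed.

(** The two derivatives are shared out: the first goes to [phi] by parts, the second falls on [g]. A
    [g] of class C^1 is what the application to div v0 calls for. *)
Lemma corr_Ck2 N g phi : 0 <= N -> Ck 1 g -> Ck 2 phi -> inside N phi ->
  Ck 2 (corr N g phi) /\ laplacian (corr N g phi) = corr N g (laplacian phi).
Proof.
move=> N0 Cg [cphi dphi] hphi; have [cg dg] := Cg.
have Cphi : Ck 1 phi by split=> // i; have [? [? _]] := dphi i.
have cdphi i : continuous (partial i phi) := (dphi i).2.1.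
have cddphi i j : continuous (partial j (partial i phi)) := ((dphi i).2.2 j).2.1.
have cdg i : continuous (partial i g) := (dg i).2.1.
have E1 i : partial i (corr N g phi) = (fun z => - corr N g (partial i phi) z).
  by rewrite (corr_partial N i Cg cphi).2 corr_by_parts.
have D2 i j := @partial_opp (corr N g (partial i phi)) j (corr_partial N j Cg (cdphi i)).1.
have E2 i j : partial j (partial i (corr N g phi)) =
    (fun z => - corr N (partial j g) (partial i phi) z).
  by rewrite E1 (D2 i j).2 (corr_partial N j Cg (cdphi i)).2.
split.
  split; first exact: continuous_corr.
  move=> i; split; first exact: (corr_partial N i Cg cphi).1.
  have c0 := @continuous_corr N _ _ cg (cdphi i).
  split; first by rewrite E1; cont.
  move=> j; split; first by rewrite E1; exact: (D2 i j).1.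
  have c1 := @continuous_corr N _ _ (cdg j) (cdphi i).
  by split=> //; rewrite E2; cont.
apply/funext => z; rewrite /laplacian corr_sumr//; apply: eq_bigr => i _.
rewrite E2 (@corr_by_parts N g (partial i phi) i N0 Cg _ (@inside_partial N phi i hphi)) ?opprK//.
exact: (dphi i).2.
Qed.

Lemma sphere_meanE s g x : continuous g ->
  sphere_mean s g x = (4 * pi)^-1 * sphint (fun y => g (x + s *: y)).
Proof. by move=> cg; rewrite /sphere_mean sphere_integralE//; cont. Qed.

Lemma continuous_sphere_mean (T : topologicalType) (r : T -> R) (x : T -> pt R) g :
  continuous g -> continuous r -> continuous x ->
  continuous (fun t => sphere_mean (r t) g (x t)).
Proof.
move=> cg cr cx.
rewrite (_ : (fun t => _) = (fun t => (4 * pi)^-1 * sphint (fun y => g (x t + r t *: y)))).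
  have [_ Sc _] := @sphint_integrator R.
  have cS : continuous (fun t => sphint (fun y => g (x t + r t *: y))).
    have c1 : continuous (fun u : T * pt R => x u.1) by apply: continuous_compose cx _; cont.
    have c2 : continuous (fun u : T * pt R => r u.1) by apply: continuous_compose cr _; cont.
    by apply: (Sc T (fun u : T * pt R => g (x u.1 + r u.1 *: u.2))); cont.
  by cont.
by apply/funext => t; rewrite sphere_meanE.
Qed.

Lemma boxint_sphere_mean N s g phi : continuous g -> continuous phi ->
  boxint N (fun x => s * sphere_mean s g x * phi x) = wmean (corr N g phi) s.
Proof.
move=> cg cphi; have IB := @boxint_integrator R N.
transitivity (boxint N (fun x => s * (4 * pi)^-1 *
    sphint (fun y => phi x * g (x + s *: y)))).
  congr boxint; apply/funext => x; rewrite sphere_meanE// integratorZ; last 2 first.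
  - exact: sphint_integrator.
  - by cont.
  by ring.
have cF : continuous (fun u : pt R * pt R => phi u.1 * g (u.1 + s *: u.2)) by cont.
rewrite integratorZ//; last first.
  by have [_ Sc _] := @sphint_integrator R; exact: (Sc _ _ cF).
have E1 : boxint N (fun x => sphint (fun y => phi x * g (x + s *: y))) =
    sphint (fun y => boxint N (fun x => phi x * g (x + s *: y))).
  exact: (commuting_sphint IB cF).
have E2 : (fun y => boxint N (fun x => phi x * g (x + s *: y))) =
    (fun y => corr N g phi (s *: y)).
  by apply/funext => y; rewrite /corr; under eq_fun do rewrite mulrC.
by rewrite E1 E2 -mulrA.
Qed.

Lemma continuous_wave_field s f g h : continuous f -> continuous g -> continuous h ->
  continuous (fun x => f x + segint 0 s (fun r => r * sphere_mean r g x)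
    - s * sphere_mean s h x).
Proof.
move=> cf cg ch; have [_ Ic _] := @segint_integrator R 0 s.
have c1 : continuous (fun x => segint 0 s (fun r => r * sphere_mean r g x)).
  apply: (Ic _ (fun u : pt R * R => u.2 * sphere_mean u.2 g u.1)).
  have c2 : continuous (fun u : pt R * R => sphere_mean u.2 g u.1).
    by apply: continuous_sphere_mean => //; cont.
  by cont.
have c3 : continuous (fun x => sphere_mean s h x) by apply: continuous_sphere_mean => //; cont.
by cont.
Qed.

Lemma boxint_wave_field N s f g h phi :
  continuous f -> continuous g -> continuous h -> continuous phi ->
  boxint N (fun x => (f x + segint 0 s (fun r => r * sphere_mean r g x)
    - s * sphere_mean s h x) * phi x) =
  corr N f phi 0 + segint 0 s (wmean (corr N g phi)) - wmean (corr N h phi) s.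
Proof.
move=> cf cg ch cphi; have IB := @boxint_integrator R N.
have cF : continuous (fun u : pt R * R => u.2 * sphere_mean u.2 g u.1 * phi u.1).
  have c2 : continuous (fun u : pt R * R => sphere_mean u.2 g u.1).
    by apply: continuous_sphere_mean => //; cont.
  by cont.
have cG : continuous (fun x => segint 0 s (fun r => r * sphere_mean r g x * phi x)).
  by have [_ Ic _] := @segint_integrator R 0 s; exact: (Ic _ _ cF).
have c3 : continuous (fun x => sphere_mean s h x).
  by apply: continuous_sphere_mean ch _ _; cont.
have c4 : continuous (fun x => s * sphere_mean s h x * phi x) by cont.
have cH := continuous_opp c4.
have cfphi : continuous (fun x => f x * phi x) by cont.
transitivity (boxint N (fun x => f x * phi x +
    (segint 0 s (fun r => r * sphere_mean r g x * phi x) + - (s * sphere_mean s h x * phi x)))).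
  congr boxint; apply/funext => x.
  have -> : segint 0 s (fun r => r * sphere_mean r g x * phi x) =
      segint 0 s (fun r => r * sphere_mean r g x) * phi x.
    rewrite mulrC -(integratorZ _ (@segint_integrator R 0 s)).
      by apply: segint_eq => r _; rewrite mulrC.
    have c2 : continuous (fun r => sphere_mean r g x) by apply: continuous_sphere_mean => //; cont.
    by cont.
  by ring.
have E1 : boxint N (fun x => f x * phi x) = corr N f phi 0.
  by rewrite /corr; under [in RHS]eq_fun do rewrite addr0.
have E2 : boxint N (fun x => segint 0 s (fun r => r * sphere_mean r g x * phi x)) =
    segint 0 s (wmean (corr N g phi)).
  transitivity (segint 0 s (fun r => boxint N (fun x => r * sphere_mean r g x * phi x))).
    exact: (commuting_segint 0 s IB cF).
  by apply: segint_eq => r _; exact: boxint_sphere_mean.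
have E3 : boxint N (fun x => - (s * sphere_mean s h x * phi x)) = - wmean (corr N h phi) s.
  by have -> := integratorN IB c4; rewrite boxint_sphere_mean.
have -> := integratorD IB cfphi (continuous_add cG cH).
by have -> := integratorD IB cG cH; rewrite E1 E2 E3 addrA.
Qed.

End Correlation.

(** * Regular distributions *)

Section RegularDistributions.
Context {R : realType}.
Implicit Types (phi psi : test_fun R) (f : pt R -> R) (N : R).

Lemma test_Ck n phi : Ck n phi.
Proof. by have := test_valP phi; rewrite inE => -[]. Qed.

Lemma test_continuous phi : continuous phi.
Proof. exact: (test_Ck 0 phi).1. Qed.

Lemma test_inside phi : exists2 N, 0 <= N & inside N phi.
Proof.
have := test_valP phi; rewrite inE => -[_ /compact_sub_box[N N0 h]].
by exists N => //; exact: ltW.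
Qed.

Lemma inside_le N N' (f : pt R -> R) : N <= N' -> inside N f -> inside N' f.
Proof. by move=> NN' h; apply: subset_trans h _ => x hx i; exact: lt_le_trans (hx i) NN'. Qed.

(** The continuity proof is an argument because the linear structure attached to this functional
    depends on it. *)
Definition pairing f (cf : continuous f) (phi : test_fun R) : R :=
  integral3 (fun x => f x * phi x).

Lemma pairing_boxint N f (cf : continuous f) phi : inside N phi ->
  pairing cf phi = boxint N (fun x => f x * phi x).
Proof.
move=> h; have cphi := @test_continuous phi.
apply: integral3_boxint; first exact: continuous_mul.
move=> x; rewrite mulf_eq0 negb_or => /andP[_ px] i; apply/ltW/h.
exact: subset_closure.
Qed.

Lemma pairing_linear f (cf : continuous f) : linear (pairing cf).
Proof.
move=> a phi psi.
have [N1 N10 h1] := test_inside phi; have [N2 N20 h2] := test_inside psi.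
have [N3 N30 h3] := test_inside (a *: phi + psi).
(* One cube for [phi], [psi] and their combination, so that all three pairings are values of the
   same [boxint]. *)
pose N := Num.max N1 (Num.max N2 N3).
have cphi := @test_continuous phi; have cpsi := @test_continuous psi.
rewrite (@pairing_boxint N _ _ phi); last by apply: inside_le h1; rewrite le_max lexx.
rewrite (@pairing_boxint N _ _ psi); last by apply: inside_le h2; rewrite !le_max lexx orbT.
rewrite (@pairing_boxint N); last by apply: inside_le h3; rewrite !le_max lexx !orbT.
have [Bl _ _] := @boxint_integrator R N.
apply: etrans (Bl a _ _ (continuous_mul cf cphi) (continuous_mul cf cpsi)).
by congr boxint; apply/funext => x /=; rewrite !fctE /GRing.scale/=; ring.
Qed.

HB.instance Definition _ f (cf : continuous f) :=
  GRing.isLinear.Build R (test_fun R) R _ (pairing cf) (pairing_linear cf).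

Lemma segint_bound a b (k : R) (g : R -> R) : a <= b -> continuous g ->
  (forall x, a <= x <= b -> `|g x| <= k) -> `|segint a b g| <= k * (b - a).
Proof.
move=> ab cg gk; rewrite -segint_cst//; apply: le_trans.
  by apply: le_normr_Rintegral => //; exact: continuous_segment_integrable.
apply: le_Rintegral => //.
- apply: continuous_segment_integrable => x; apply: cvg_norm; exact: cg.
- exact/continuous_segment_integrable/cst_continuous.
Qed.

Lemma boxint_bound N (k : R) f : 0 <= N -> continuous f ->
  (forall x, box N x -> `|f x| <= k) -> `|boxint N f| <= k * (N - - N) ^+ 3.
Proof.
move=> N0 cf fk; have NN : - N <= N by lra.
have [_ Ic _] := @segint_integrator R (- N) N.
have c3 : continuous (fun u : R * R * R => f (pt_of u)) by cont.
have c2 : continuous (fun u : R * R => segint (- N) N (fun z => f (pt_of (u, z)))).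
  exact: (Ic _ _ c3).
have c1 : continuous (fun x : R => segint (- N) N (fun y =>
    segint (- N) N (fun z => f (pt_of (x, y, z))))).
  exact: (Ic _ _ c2).
rewrite exprSr exprSr expr1 !mulrA.
apply: segint_bound => // x hx; apply: segint_bound => //.
  exact: (@continuous_section R R R _ x c2).
move=> y hy; apply: segint_bound => //.
  exact: (@continuous_section (R * R)%type R R _ (x, y) c3).
by move=> z hz; apply: fk; apply: ord3_ind; rewrite /pt_of row3E/= ler_norml.
Qed.

Lemma pairing_cont f (cf : continuous f) (K : set (pt R)) : compact K ->
  exists (n : nat) (C : R), forall phi (M : R), supp phi `<=` K ->
    (forall s : seq 'I_3, (size s <= n)%N -> forall x, `|partials s phi x| <= M) ->
    `|pairing cf phi| <= C * M.
Proof.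
move=> cK; have [N N0 KN] := compact_sub_box cK.
have [m m0 fm] := continuous_compact_bound (@compact_box R N) cf.
(* The distribution has order 0: the constant is the bound of [f] on the cube times the volume of
   the cube, whose side is 2 N. *)
exists 0%N, (m * (N - - N) ^+ 3) => phi M phiK phiM.
have h : inside N phi by apply: subset_trans phiK KN.
have cphi := @test_continuous phi.
rewrite (pairing_boxint _ h) mulrAC; apply: boxint_bound; first exact: ltW.
  exact: continuous_mul.
move=> x xN; rewrite normrM ler_pM//; first exact: fm.
exact: (phiM [::]).
Qed.

Definition regular_distr f (cf : continuous f) : Defs.distribution R :=
  Distribution (@pairing_cont f cf).

Lemma regular_distrP f (cf : continuous f) : regular f (regular_distr cf).
Proof. by split; first exact: continuous_loc_integrable. Qed.

Variables (a : R) (n : nat) (S : 'I_n -> Defs.distribution R).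

Definition comb_val phi : R := a * \sum_(k < n) S k phi.

Lemma comb_linear : linear comb_val.
Proof.
move=> b phi psi; rewrite /comb_val.
under eq_bigr do rewrite linearP.
by rewrite big_split/= mulrDr -scaler_sumr /GRing.scale/= mulrCA.
Qed.

HB.instance Definition _ := GRing.isLinear.Build R (test_fun R) R _ comb_val comb_linear.

Lemma comb_cont (K : set (pt R)) : compact K ->
  exists (m : nat) (C : R), forall phi (M : R), supp phi `<=` K ->
    (forall s : seq 'I_3, (size s <= m)%N -> forall x, `|partials s phi x| <= M) ->
    `|comb_val phi| <= C * M.
Proof.
move=> cK; have [m mP] := choice (fun k => distr_cont (S k) cK).
have [C CP] := choice mP.
exists (\max_(k < n) m k), (`|a| * \sum_(k < n) C k) => phi M phiK phiM.
rewrite normrM -mulrA ler_wpM2l// mulr_suml; apply: le_trans (ler_norm_sum _ _ _) _.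
apply: ler_sum => k _; apply: CP => // s sm x; apply: phiM.
by apply: leq_trans sm _; exact: leq_bigmax.
Qed.

Definition comb_distr : Defs.distribution R := Distribution comb_cont.

End RegularDistributions.

(** * Derivatives and continuity on the half-line of times *)

Section OneSided.
Context {R : realType}.

(** The quotient only sees increments with [0 <= t + h], so [q] can be exchanged for a function [E]
    that agrees with it there and has an ordinary derivative at [t], also when [t = 0]. *)
Lemma one_sided_derive (q E : R -> R) (t l : R) : 0 <= t ->
  (forall s, 0 <= s -> q s = E s) -> is_derive t (1 : R) E l ->
  h^-1 * (q (t + h) - q t) @[h --> within [set h | 0 <= t + h] (0 : R)^'] --> l.
Proof.
move=> t0 qE D.
have L : h^-1 * (E (t + h) - E t) @[h --> (0 : R)^'] --> l.
  have := @ex_derive _ _ _ _ _ _ _ D; rewrite /derivable => /cvg_ex[k kl].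
  have := @derive_val _ _ _ _ _ _ _ D; rewrite /derive (cvg_lim _ kl)// => <-.
  apply: cvg_trans kl; apply: near_eq_cvg; near=> h.
  by rewrite /= [h *: 1]mulr1 [h + t]addrC.
have L' : h^-1 * (E (t + h) - E t) @[h --> within [set h | 0 <= t + h] (0 : R)^'] --> l.
  exact: cvg_within_filter.
apply: cvg_trans L'; apply: near_eq_cvg; rewrite near_withinE.
by apply: nearW => h th; rewrite !qE.
Unshelve. all: by end_near. Qed.

Lemma half_line_continuous (q E : R -> R) :
  (forall s, 0 <= s -> q s = E s) -> (forall s, 0 <= s -> {for s, continuous E}) ->
  {within `[0, +oo[, continuous q}.
Proof.
move=> qE cE; apply: (@subspace_eq_continuous _ _ _ E).
  by move=> s; rewrite inE/= in_itv/= andbT => s0; exact/esym/qE.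
by apply: continuous_in_subspaceT => s; rewrite inE/= in_itv/= andbT; exact: cE.
Qed.

Lemma segint_primitive (w : R -> R) (s : R) : continuous w -> -1 < s ->
  is_derive s (1 : R) (fun s => segint (-1) s w) (w s).
Proof.
move=> cw s1; have [] := @continuous_FTC1_closed R w (-1) s (s + 1) _ _ _ (cw s).
- by rewrite ltrDl.
- exact: continuous_segment_integrable.
- exact: s1.
- by move=> D1 D2; split; [exact: D1|rewrite -derive1E; exact: D2].
Qed.

Lemma segint_subl (w : R -> R) (s : R) : continuous w -> 0 <= s ->
  segint 0 s w = segint (-1) s w - segint (-1) 0 w.
Proof.
move=> cw s0; have i1 := @continuous_segment_integrable R (-1) s w cw.
have b1 : (BLeft (-1 : R) <= BRight 0)%O by rewrite bnd_simp lerN10.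
have b2 : (BRight (0 : R) <= BRight s)%O by rewrite bnd_simp.
rewrite /segint (Rintegral_itvB i1 b1 b2) Rintegral_itv_obnd_cbnd; first by [].
apply: (@integrableS _ _ _ lebesgue_measure `[0, s]) => //;
  last exact: continuous_segment_integrable.
exact: subset_itv_oc_cc.
Qed.

End OneSided.

(** * The wave system *)

Section WaveSystem.
Context {R : realType}.
Implicit Types (f g h : pt R -> R) (N s : R) (i : 'I_3).

Lemma CkS n f : Ck n.+1 f -> Ck n f.
Proof.
elim: n f => [|n IH] f [cf df]; first by [].
by split=> // i; split; [exact: (df i).1|exact: IH (df i).2].
Qed.

Lemma Ck_sum3 n (f : 'I_3 -> pt R -> R) : (forall i, Ck n (f i)) ->
  Ck n (fun x => \sum_(i < 3) f i x).
Proof.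
move=> Cf; have := Ck_lin 1 (Ck_lin 1 (Cf 0) (Cf 1)) (Cf (1 + 1)).
congr (Ck n); apply/funext => x; rewrite sum3 !scale1r; reflexivity.
Qed.

Lemma wmeanN f s : continuous f -> wmean (fun z => - f z) s = - wmean f s.
Proof.
move=> cf; have c1 : continuous (fun y : pt R => f (s *: y)) by cont.
by rewrite /wmean; have -> := integratorN (@sphint_integrator R) c1; rewrite !mulrN.
Qed.

Lemma wmean_sum3 (f : 'I_3 -> pt R -> R) s : (forall i, continuous (f i)) ->
  wmean (fun z => \sum_(i < 3) f i z) s = \sum_(i < 3) wmean (f i) s.
Proof.
move=> cf; have c1 i : continuous (fun y : pt R => f i (s *: y)) by cont.
by rewrite /wmean; have -> := integrator_sum (@sphint_integrator R) c1; rewrite !mulr_sumr.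
Qed.

Lemma corr_laplacianr N g f z : continuous g -> Ck 2 f ->
  corr N g (laplacian f) z = \sum_(i < 3) corr N g (partial i (partial i f)) z.
Proof.
move=> cg Cf; apply: (@corr_sumr R N 3 g (fun i => partial i (partial i f)) z cg) => i.
exact: ((Cf.2 i).2.2 i).2.1.
Qed.

(** Brings the Laplacian of p0, which is only continuous, into the form that [corr_Ck2] identifies
    with the Laplacian of the correlation itself, ready for Darboux's equation. *)
Lemma corr_laplacian N g f : 0 <= N -> Ck 2 g -> Ck 2 f -> inside N f ->
  corr N (laplacian g) f = corr N g (laplacian f).
Proof.
move=> N0 Cg Cf hf; apply/funext => z.
have E1 : corr N (laplacian g) f z = \sum_(i < 3) corr N (partial i (partial i g)) f z.
  apply: (@corr_suml R N 3 (fun i => partial i (partial i g)) f z Cf.1) => i.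
  exact: ((Cg.2 i).2.2 i).2.1.
rewrite E1 (corr_laplacianr N z Cg.1 Cf); apply: eq_bigr => i _.
have E2 := corr_by_parts i N0 (Cg.2 i).2 (CkS Cf) hf.
have E3 := corr_by_parts i N0 (CkS Cg) (Cf.2 i).2 (@inside_partial R N f i hf).
by rewrite E2 E3 opprK.
Qed.

(** Common shape of both formulas at s = ct: (f, g, h) is (p0, Delta p0, div v0) for the pressure
    and (v0_i, d_i div v0, d_i p0) for a velocity component. *)
Definition wave_field s f g h (x : pt R) : R :=
  f x + segint 0 s (fun r => r * sphere_mean r g x) - s * sphere_mean s h x.

Variables (p0 : pt R -> R) (w : 'I_3 -> pt R -> R).
Hypotheses (Cp0 : Ck 2 p0) (Cw : forall i, Ck 2 (w i)).

Definition divergence (x : pt R) : R := \sum_(i < 3) partial i (w i) x.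

Let cp0 : continuous p0 := Cp0.1.
Let C1p0 : Ck 1 p0 := CkS Cp0.
Let C1dp0 i : Ck 1 (partial i p0) := (Cp0.2 i).2.
Let cdp0 i : continuous (partial i p0) := (@C1dp0 i).1.
Let cddp0 i : continuous (partial i (partial i p0)) := ((@C1dp0 i).2 i).2.1.
Let cw i : continuous (w i) := (Cw i).1.
Let C1div : Ck 1 divergence.
Proof. by apply: (@Ck_sum3 1 (fun i => partial i (w i))) => i; exact: ((Cw i).2 i).2. Qed.
Let cdiv : continuous divergence := C1div.1.
Let cddiv i : continuous (partial i divergence) := (C1div.2 i).2.1.

Let clap : continuous (laplacian p0).
Proof. by rewrite /laplacian; cont. Qed.

Lemma pressure_continuous s : continuous (wave_field s p0 (laplacian p0) divergence).
Proof. exact: continuous_wave_field. Qed.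

Lemma velocity_continuous s i :
  continuous (wave_field s (w i) (partial i divergence) (partial i p0)).
Proof. exact: continuous_wave_field. Qed.

Definition pressure s := regular_distr (@pressure_continuous s).
Definition velocity i s := regular_distr (@velocity_continuous s i).

Section TestFunction.
Variables (phi : test_fun R) (N : R).
Hypotheses (N0 : 0 <= N) (phiN : inside N phi).

Let Cphi n : Ck n phi := @test_Ck R n phi.
Let cphi : continuous phi := (Cphi 0).1.
Let C1dphi i : Ck 1 (partial i phi) := ((Cphi 2).2 i).2.
Let cdphi i : continuous (partial i phi) := (@C1dphi i).1.
Let cddphi i : continuous (partial i (partial i phi)) := ((@C1dphi i).2 i).2.1.
Let dphiN i : inside N (partial i phi) := @inside_partial R N phi i phiN.

Let Cp : Ck 2 (corr N p0 phi) := (corr_Ck2 N0 C1p0 (Cphi 2) phiN).1.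
Let lapp : laplacian (corr N p0 phi) = corr N p0 (laplacian phi) :=
  (corr_Ck2 N0 C1p0 (Cphi 2) phiN).2.
Let Cdiv : Ck 2 (corr N divergence phi) := (corr_Ck2 N0 C1div (Cphi 2) phiN).1.
Let lapdiv : laplacian (corr N divergence phi) = corr N divergence (laplacian phi) :=
  (corr_Ck2 N0 C1div (Cphi 2) phiN).2.

(** In the notation of the overview, u_H' - u_G. It is differentiable on the whole line, while the
    identification with the pairing is made for [0 <= s]. *)
Definition pressure_pairing s := dwmean (corr N p0 phi) s - wmean (corr N divergence phi) s.

Lemma pressureE s : 0 <= s -> pressure s phi = pressure_pairing s.
Proof.
move=> s0; rewrite /= (pairing_boxint _ phiN) /wave_field.
rewrite (boxint_wave_field N s cp0 clap cdiv cphi).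
by rewrite (corr_laplacian N0 Cp0 (Cphi 2) phiN) -lapp (darboux Cp s0).
Qed.

Lemma pressure_pairing_derive s : is_derive s (1 : R) pressure_pairing
  (wmean (laplacian (corr N p0 phi)) s - dwmean (corr N divergence phi) s).
Proof.
apply: is_deriveB; first exact: dwmean_is_derive.
exact: wmean_is_derive (CkS Cdiv).
Qed.

(** The right-hand side is the derivative found in [pressure_pairing_derive]. By parts, the v0 terms
    sum to - G(0) and the grad div v0 terms to minus the integral of u_(Delta G); Darboux's equation
    merges them into - u_G'. The grad p0 terms give u_(Delta H). Only the sum over i produces these
    Laplacians. *)
Lemma velocity_divergence s : 0 <= s ->
  \sum_(i < 3) velocity i s (test_D i phi) =
  wmean (laplacian (corr N p0 phi)) s - dwmean (corr N divergence phi) s.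
Proof.
move=> s0.
have cN g : continuous g -> forall i, continuous (corr N g (partial i (partial i phi))).
  by move=> cg i; exact: continuous_corr.
have corrE g : continuous g -> corr N g (laplacian phi) =
    (fun z => \sum_(i < 3) corr N g (partial i (partial i phi)) z).
  by move=> cg; apply/funext => z; exact: corr_laplacianr cg (Cphi 2).
transitivity (\sum_(i < 3) (- corr N (partial i (w i)) phi 0 +
    (- segint 0 s (wmean (corr N divergence (partial i (partial i phi)))) +
     wmean (corr N p0 (partial i (partial i phi))) s))).
  apply: eq_bigr => i _; rewrite /= (@pairing_boxint _ N _ _ (test_D i phi) (@dphiN i)).
  rewrite /wave_field (boxint_wave_field N s (@cw i) (@cddiv i) (@cdp0 i) (@cdphi i)) -addrA.
  congr (_ + (_ + _)).
  - by rewrite (corr_by_parts i N0 (CkS (Cw i)) (Cphi 1) phiN) opprK.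
  - rewrite (corr_by_parts i N0 C1div (@C1dphi i) (@dphiN i)).
    rewrite -(integratorN (@segint_integrator R 0 s)); last first.
      by apply: continuous_wmean; exact: cN.
    by apply: segint_eq => r _; rewrite wmeanN//; exact: cN.
  - rewrite (corr_by_parts i N0 C1p0 (@C1dphi i) (@dphiN i)) wmeanN ?opprK//.
    exact: cN.
rewrite big_split big_split/= !sumrN.
have -> : \sum_(i < 3) wmean (corr N p0 (partial i (partial i phi))) s =
    wmean (laplacian (corr N p0 phi)) s.
  by rewrite lapp (corrE p0 cp0) wmean_sum3//; exact: cN.
have -> : \sum_(i < 3) segint 0 s (wmean (corr N divergence (partial i (partial i phi)))) =
    segint 0 s (wmean (laplacian (corr N divergence phi))).
  rewrite -(integrator_sum (@segint_integrator R 0 s)); last first.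
    by move=> i; apply: continuous_wmean; exact: cN.
  apply: segint_eq => r _.
  by rewrite lapdiv (corrE divergence cdiv) wmean_sum3//; exact: cN.
have -> : \sum_(i < 3) corr N (partial i (w i)) phi 0 = corr N divergence phi 0.
  by rewrite corr_suml// => i; exact: ((Cw i).2 i).2.1.
by rewrite -(darboux Cdiv s0); ring.
Qed.

Variable i : 'I_3.

Let cu : continuous (wmean (corr N (partial i divergence) phi)).
Proof. by apply: continuous_wmean; exact: continuous_corr. Qed.

(* The base point -1 makes the integral differentiable on both sides of [s = 0]. *)
Definition velocity_pairing s := corr N (w i) phi 0 +
  (segint (-1) s (wmean (corr N (partial i divergence) phi)) -
   segint (-1) 0 (wmean (corr N (partial i divergence) phi))) -
  wmean (corr N (partial i p0) phi) s.

Lemma velocityE s : 0 <= s -> velocity i s phi = velocity_pairing s.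
Proof.
move=> s0; rewrite /= (pairing_boxint _ phiN) /wave_field.
by rewrite (boxint_wave_field N s (@cw i) (@cddiv i) (@cdp0 i) cphi) segint_subl.
Qed.

(** The velocity pairing is differentiated as it stands. Darboux's equation serves to rewrite the
    pressure tested against d_i phi, which takes three derivatives of [phi]; afterwards one
    integration by parts matches the remaining terms on each side. *)
Lemma velocity_pairing_derive s : 0 <= s ->
  is_derive s (1 : R) velocity_pairing (pressure s (test_D i phi)).
Proof.
move=> s0.
have -> : pressure s (test_D i phi) =
    wmean (corr N (partial i divergence) phi) s + dwmean (corr N p0 (partial i phi)) s.
  rewrite /= (@pairing_boxint _ N _ _ (test_D i phi) (@dphiN i)) /wave_field.
  rewrite (boxint_wave_field N s cp0 clap cdiv (@cdphi i)).
  have Cd3 : Ck 2 (partial i phi) := ((Cphi 3).2 i).2.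
  have [Cc lapc] := corr_Ck2 N0 C1p0 Cd3 (@dphiN i).
  rewrite (corr_laplacian N0 Cp0 Cd3 (@dphiN i)) -lapc (darboux Cc s0).
  rewrite addrC; congr (_ + _).
  rewrite (corr_by_parts i N0 C1div (Cphi 1) phiN) wmeanN//.
  exact: continuous_corr.
have -> : velocity_pairing = (fun s => (corr N (w i) phi 0 +
    - segint (-1) 0 (wmean (corr N (partial i divergence) phi)) +
    segint (-1) s (wmean (corr N (partial i divergence) phi))) +
    wmean (corr N p0 (partial i phi)) s).
  apply/funext => r; rewrite /velocity_pairing.
  rewrite (corr_by_parts i N0 C1p0 (Cphi 1) phiN) wmeanN; last exact: continuous_corr.
  by ring.
have s1 : -1 < s by lra.
apply: is_derive_addf.
  rewrite -[X in is_derive _ _ _ X]add0r.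
  exact: (is_derive_addf (is_derive_cstf _ s) (segint_primitive cu s1)).
apply: wmean_is_derive.
exact: CkS (corr_Ck2 N0 C1p0 ((Cphi 3).2 i).2 (@dphiN i)).1.
Qed.

End TestFunction.
End WaveSystem.

(** * Time derivatives of the distributions and the Cauchy problem *)

Section CauchySolution.
Context {R : realType}.

Lemma is_derive_scale_arg (f : R -> R) (c t df : R) :
  is_derive (c * t) (1 : R) f df -> is_derive t (1 : R) (fun t => f (c * t)) (c * df).
Proof.
move=> D; have L : is_derive t (1 : R) (fun t => c * t) c.
  apply: is_derive_eqf (is_derive_mulf (is_derive_cstf c t) (is_derive_idf t)) _.
  by rewrite mul0r add0r mulr1.
by rewrite mulrC; exact: (@is_derive1_comp R f (fun t => c * t) t df c).
Qed.

Lemma coordf_grad (f : pt R -> R) i : coordf (grad f) i = partial i f.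
Proof. by apply/funext => x; rewrite /coordf /grad mxE. Qed.

Lemma div_grad (f : pt R -> R) : div (grad f) = laplacian f.
Proof.
apply/funext => x; apply: eq_bigr => i _.
by rewrite -[fun y => _]/(coordf (grad f) i) coordf_grad.
Qed.

Lemma div_coordf (v : pt R -> pt R) : div v = divergence (coordf v).
Proof. by []. Qed.

Variables (c : R) (p0 : pt R -> R) (w : 'I_3 -> pt R -> R).
Hypotheses (c0 : 0 < c) (Cp0 : Ck 2 p0) (Cw : forall i, Ck 2 (w i)).

Let P t := pressure Cp0 Cw (c * t).
Let V i t := velocity Cp0 Cw i (c * t).

(** The time derivatives are defined by the equations themselves. The system then holds by
    construction, and its content becomes the claim that these distributions really are the
    derivatives. *)
Definition velocity_rate i t := comb_distr (- c) (fun _ : 'I_1 => distr_D i (P t)).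
Definition pressure_rate t := comb_distr (- c) (fun i : 'I_3 => distr_D i (V i t)).

Lemma velocity_rateE i t phi : velocity_rate i t phi = c * P t (test_D i phi).
Proof. by rewrite /= /comb_val big_ord1 mulrNN. Qed.

Lemma pressure_rateE t phi :
  pressure_rate t phi = c * \sum_(i < 3) V i t (test_D i phi).
Proof. by rewrite /= /comb_val sumrN mulrNN. Qed.

Let ct0 t : 0 <= t -> 0 <= c * t.
Proof. by move=> t0; rewrite mulr_ge0// ltW. Qed.

Lemma velocity_C1 i : distr_C1 (V i) (velocity_rate i).
Proof.
split=> [t t0 phi|phi].
  have [N N0 phiN] := test_inside phi.
  rewrite velocity_rateE.
  apply: (@one_sided_derive R (fun t => V i t phi)
    (fun t => velocity_pairing p0 w phi N i (c * t))).
  - exact: t0.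
  - by move=> s s0; apply: (velocityE Cp0 Cw phiN i); exact: ct0.
  - apply: is_derive_scale_arg; apply: velocity_pairing_derive => //; exact: ct0.
(* The rate is c times the pressure tested against d_i phi, so its continuity follows from the
   differentiability of that pairing. *)
have [N N0 phiN] := test_inside (test_D i phi).
apply: (@half_line_continuous R _ (fun t => c * pressure_pairing p0 w (test_D i phi) N (c * t))).
  move=> s s0; rewrite velocity_rateE; congr (_ * _).
  by apply: (pressureE Cp0 Cw N0 phiN); exact: ct0.
move=> s s0; exact: is_derive_continuous (is_derive_mulf (is_derive_cstf c s)
  (is_derive_scale_arg (pressure_pairing_derive Cp0 Cw N0 phiN (c * s)))).
Qed.

Lemma pressure_C1 : distr_C1 P pressure_rate.
Proof.
split=> [t t0 phi|phi].
  have [N N0 phiN] := test_inside phi.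
  rewrite pressure_rateE.
  apply: (@one_sided_derive R (fun t => P t phi) (fun t => pressure_pairing p0 w phi N (c * t))).
  - exact: t0.
  - by move=> s s0; apply: (pressureE Cp0 Cw N0 phiN); exact: ct0.
  - apply: is_derive_scale_arg; rewrite (velocity_divergence Cp0 Cw N0 phiN (ct0 t0)).
    exact: (pressure_pairing_derive Cp0 Cw N0 phiN).
have [N N0 phiN] := test_inside phi.
have dphiN i : inside N (test_D i phi) by exact: inside_partial.
apply: (@half_line_continuous R _ (fun t => c * \sum_(i < 3)
    velocity_pairing p0 w (test_D i phi) N i (c * t))).
  move=> s s0; rewrite pressure_rateE; congr (_ * _); apply: eq_bigr => i _.
  by apply: (velocityE Cp0 Cw (@dphiN i) i); exact: ct0.
move=> s s0; exact: is_derive_continuous (is_derive_mulf (is_derive_cstf c s)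
  (is_derive_sum3 (fun i => is_derive_scale_arg
    (velocity_pairing_derive Cp0 Cw N0 (@dphiN i) i (ct0 s0))))).
Qed.

End CauchySolution.

Unset Implicit Arguments.

Theorem theorem3p1 (R : realType) (c : R)
    (p0 : pt R -> R) (v0 : pt R -> pt R)
    (p : R -> pt R -> R) (v : R -> pt R -> pt R) :
  0 < c ->
  Ck 2 p0 -> Linfty p0 ->
  (forall i, Ck 2 (coordf v0 i)) -> (forall i, Linfty (coordf v0 i)) ->
  (forall (t : R) x, 0 <= t ->
     p t x = p0 x
       + \int[lebesgue_measure]_(r in `[0, c * t])
           (r * sphere_mean r (div (grad p0)) x)
       - c * t * sphere_mean (c * t) (div v0) x) ->
  (forall (t : R) x i, 0 <= t ->
     coordf (v t) i x = coordf v0 i x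
       + \int[lebesgue_measure]_(r in `[0, c * t])
           (r * sphere_mean r (coordf (grad (div v0)) i) x)
       - c * t * sphere_mean (c * t) (coordf (grad p0) i) x) ->
  distributional_solution c v0 p0 v p.
Proof.
move=> c0 Cp0 _ Cv0 _ pE vE.
have pwE t : 0 <= t ->
    p t = wave_field (c * t) p0 (laplacian p0) (divergence (coordf v0)).
  by move=> t0; apply/funext => x; rewrite (pE t x t0) div_grad div_coordf.
have vwE t i : 0 <= t -> coordf (v t) i = wave_field (c * t) (coordf v0 i)
    (partial i (divergence (coordf v0))) (partial i p0).
  by move=> t0; apply/funext => x; rewrite (vE t x i t0) !coordf_grad div_coordf.
have reg t : 0 <= t ->
    (forall i, regular (coordf (v t) i) (velocity Cp0 Cv0 i (c * t))) /\
    regular (p t) (pressure Cp0 Cv0 (c * t)).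
  by move=> t0; split=> [i|]; [rewrite (vwE t i t0)|rewrite (pwE t t0)]; exact: regular_distrP.
(* At time 0 the integral runs over a single point and the last term has the factor [c * 0]. *)
have v0E i : coordf (v 0) i = coordf v0 i.
  by apply/funext => x; rewrite (vE 0 x i (lexx 0)) mulr0 mul0r subr0 set_itv1 Rintegral_set1 addr0.
have p0E : p 0 = p0.
  by apply/funext => x; rewrite (pE 0 x (lexx 0)) mulr0 mul0r subr0 set_itv1 Rintegral_set1 addr0.
exists (fun i t => velocity Cp0 Cv0 i (c * t)), (velocity_rate c Cp0 Cv0),
  (fun t => pressure Cp0 Cv0 (c * t)), (pressure_rate c Cp0 Cv0); split.
- exact: reg.
- by split=> [i|]; [exact: velocity_C1|exact: pressure_C1].
- by move=> t t0 i phi; rewrite velocity_rateE [distr_D _ _ _]/(- _) mulrN subrr.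
- by move=> t t0 phi; rewrite pressure_rateE sumrN mulrN subrr.
- have [rv rp] := reg 0 (lexx 0).
  by split=> [i|]; [rewrite -v0E|rewrite -[X in regular X]p0E].
Qed.
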